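(* The total number $N(d)$ of not affinely similar 2-attractors in dimension $d$ satisfies the following estimates: $$\frac{d^2}{16}-\frac{43d}{36}-\frac56\ \le\ N(d)\ \le\ 2^{\,d\left(1+\frac{16\ln\ln d}{\ln d}\right)}.$$
   Context: An integer $d\times d$ matrix $M$ is called expanding if all its (complex) eigenvalues have modulus strictly greater than $1$. Let $M$ be an integer expanding $d\times d$ matrix with $|\det M|=2$ and let $D=\{\boldsymbol d_0,\boldsymbol d_1\}\subset\mathbb{Z}^d$ with $\boldsymbol d_1-\boldsymbol d_0\notin M\mathbb{Z}^d$. The 2-attractor generated by $M$ and $D$ is the compact set $G(M,D)=\{\sum_{k=1}^{\infty}M^{-k}\boldsymbol a_k : \boldsymbol a_k\in D \text{ for all } k\}\subset\mathbb{R}^d$. Two subsets of $\mathbb{R}^d$ are affinely similar if one is the image of the other under an invertible affine map of $\mathbb{R}^d$. $N(d)$ is the number of equivalence classes of 2-attractors in $\mathbb{R}^d$ under affine similarity.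
   Formalization: The upper bound is stated only for d ≥ 3: for d = 1 the expression ln ln d / ln d is undefined, and for d = 2 the right-hand side is below 1 while N(2) ≥ 1; the lower bound is stated for all d ≥ 1. *)

(* Defs.v *)
From HB Require Import structures.
From mathcomp Require Import all_boot all_order all_algebra.
From mathcomp Require Import finmap complex.
From mathcomp Require Import all_classical all_reals all_analysis.

Set Implicit Arguments.
Unset Strict Implicit.
Unset Printing Implicit Defensive.

Import Order.TTheory GRing.Theory Num.Theory.
Import numFieldNormedType.Exports.

Local Open Scope classical_set_scope.
Local Open Scope ring_scope.

(* Points of R^d and Z^d are column vectors.  The library's [eigenvalue] uses
   row eigenvectors, which gives the same spectrum; on R[i] the norm takes
   values in R[i] itself, and [<] is the strict partial order there. *)
Definition expanding (R : realType) (d : nat) (M : 'M[int]_d) : Prop :=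
  forall z : complex R,
    eigenvalue (map_mx intr M : 'M[complex R]_d) z -> 1 < `|z|.

Definition admissible (R : realType) (d : nat)
    (M : 'M[int]_d) (d0 d1 : 'cV[int]_d) : Prop :=
  [/\ expanding R M,
      `|\det M| = 2
    & ~ exists v : 'cV[int]_d, d1 - d0 = M *m v].

Definition attractor (R : realType) (d : nat)
    (M : 'M[int]_d) (d0 d1 : 'cV[int]_d) : set 'cV[R]_d :=
  [set x | exists a : nat -> 'cV[int]_d,
     (forall k, a k = d0 \/ a k = d1) /\
     (fun n => \sum_(1 <= k < n.+1)
        (invmx (map_mx intr M) ^+ k) *m map_mx intr (a k)) @ \oo --> x].
Arguments attractor R {d} M d0 d1.

Definition two_attractors (R : realType) (d : nat) : set (set 'cV[R]_d) :=
  [set G | exists (M : 'M[int]_d) (d0 d1 : 'cV[int]_d),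
     admissible R M d0 d1 /\ G = attractor R M d0 d1].
Arguments two_attractors R d : clear implicits.

Definition affinely_similar (R : realType) (d : nat)
    (G H : set 'cV[R]_d) : Prop :=
  exists (L : 'M[R]_d) (b : 'cV[R]_d),
    L \in unitmx /\ H = [set L *m x + b | x in G].

Definition attractor_classes (R : realType) (d : nat) :
    set (set (set 'cV[R]_d)) :=
  [set [set H | two_attractors R d H /\ affinely_similar G H]
     | G in two_attractors R d].
Arguments attractor_classes R d : clear implicits.

(* [fset_set] sends an infinite set to the empty one, so this is the number of
   classes only when [attractor_classes R d] is finite. *)
Definition num_attractors (R : realType) (d : nat) : nat :=
  #|` fset_set (attractor_classes R d)|.

(* Main.v *)
(** An expanding integer polynomial with constant term ±2 is irreducible, because
    every nonconstant integer factor has constant term of modulus > 1.  Hence every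
    nonzero integer vector is cyclic for [M], and passing to Krylov bases shows that
    the attractor is determined up to affine similarity by the characteristic
    polynomial [p] of [M].

    Upper bound.  Let [p*] be the reversed polynomial.  Then [p*/p] is a Blaschke
    product, so its Taylor coefficients [c_k] at 0 satisfy [sum |c_k|^2 <= 1], with
    [c_0 = ±1/2].  If two such polynomials with the same constant term have the same
    coefficients below [h], then the coefficients at [h] differ by an element of
    [Z/4], the cross product [p* q - q* p] being an integer polynomial; it is also
    antireciprocal, so [c_0, ..., c_(d-1)] determine [p].  Recording the rank of
    [4 c_k] in its coset of [Z] therefore encodes [p] by [d - 1] naturals whose
    squares sum to at most 48, and there are few such tuples.

    Lower bound.  Put [e = d1 - d0].  The width of the attractor in the direction
    [xi] is [sum_k |xi M^-k e|], so an affine similarity identifies the two zonoids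
    spanned by the vectors [M^-k e], hence these vectors up to sign and order.  The
    linear recurrence given by [p] is then transported to a multiple of the other
    characteristic polynomial; when the nonconstant coefficients are 0 or ±1 this
    forces both polynomials to have the same support.  For [a < b < c] with
    [a + b + c = d], suitable signs make [(1-Z) + (1-W) - T(1-Z)(1-W)] expanding,
    where [Z = ±x^a], [W = ±x^b], [T = ±x^c], and the support determines [(a, b)]. *)
Require Import Defs.
From HB Require Import structures.
From mathcomp Require Import all_boot all_order all_algebra.
From mathcomp Require Import finmap complex.
From mathcomp Require Import all_classical all_reals all_analysis.
From mathcomp Require Import ring lra zify.
Import Order.TTheory GRing.Theory Num.Theory.
Import numFieldNormedType.Exports.
Local Open Scope classical_set_scope.
Local Open Scope ring_scope.
Set Implicit Arguments.
Unset Strict Implicit.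
Unset Printing Implicit Defensive.

(** * Blaschke products as truncated power series *)

Lemma coef_mul_agree (A : comNzRingType) n (r p q : {poly A}) :
  (forall k, (k < n)%N -> p`_k = q`_k) ->
  forall k, (k < n)%N -> (r * p)`_k = (r * q)`_k.
Proof.
move=> H k kn; rewrite !coefM; apply: eq_bigr => i _.
by rewrite H // (leq_ltn_trans (leq_subr _ _) kn).
Qed.

(* Multiplication by a Blaschke factor is a unitary linear system with scalar state [s];
   the energy balance of the system gives the norm inequality. *)
Lemma blaschke_step (C : numClosedFieldType) n (a : C) (g : {poly C}) :
  1 < `|a| ->
  exists h : {poly C},
    (forall k, (k < n)%N ->
      (('X - a%:P) * h)`_k = ((1 - (a^*)%:P * 'X) * g)`_k) /\
    \sum_(k < n) `|h`_k| ^+ 2 <= \sum_(k < n) `|g`_k| ^+ 2.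
Proof.
move=> a1.
have a0 : a != 0 by rewrite -normr_gt0 (lt_trans _ a1).
have ac0 : a^* != 0 by rewrite conjC_eq0.
pose r := a^-1; pose w := a^* / a; pose e := 1 - r * r^*.
(* [s] lists the coefficients of X g / (1 - r X), the state of the system, and [hk] those of the
   output, because (1 - a^* X) / (X - a) = - r + w e X / (1 - r X). *)
pose s := fix s k := if k is k'.+1 then r * s k' + g`_k' else 0.
pose hk k := - r * g`_k + w * e * s k.
exists (\poly_(k < n) hk k); split.
  move=> k kn; rewrite mulrBl mulrBl mul1r !coefB -mulrA !coefCM !coefXM !coef_poly kn.
  case: k kn => [|k] kn /=.
    by rewrite /hk /= mulr0 addr0 mulr0 sub0r mulNr mulrN opprK mulrA divff // mul1r subr0.
  rewrite ltnW // /hk /= /e /w /r; rewrite fmorphV.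
  by field; rewrite a0 ac0.
have e0 : 0 <= e.
  rewrite /e -normCK subr_ge0 /r normfV exprVn invf_le1 ?exprn_gt0 ?(lt_trans _ a1) //.
  by rewrite exprn_ege1 // ltW.
suff H m : (m <= n)%N ->
   \sum_(k < m) `|(\poly_(k < n) hk k)`_k| ^+ 2 + e * `|s m| ^+ 2
     = \sum_(k < m) `|g`_k| ^+ 2.
  rewrite -(H n) // lerDl mulr_ge0 // exprn_ge0 //.
elim: m => [|m IH] mn; first by rewrite !big_ord0 /= normr0 expr0n mulr0 addr0.
rewrite !big_ord_recr /= -IH ?(ltnW mn) // -!addrA; congr (_ + _).
rewrite coef_poly mn /hk !normCK /e !(rmorphD, rmorphM, rmorphB, rmorphN, rmorph1) /=.
rewrite /w /r !(rmorphM, fmorphV) /= !conjCK.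
by field; rewrite a0 ac0.
Qed.

Lemma blaschke_product (C : numClosedFieldType) n (s : seq C) :
  all (fun a => 1 < `|a|) s ->
  exists h : {poly C},
    (forall k, (k < n)%N ->
      ((\prod_(a <- s) ('X - a%:P)) * h)`_k
        = (\prod_(a <- s) (1 - (a^*)%:P * 'X))`_k) /\
    \sum_(k < n) `|h`_k| ^+ 2 <= 1.
Proof.
elim: s => [_|a s IH /= /andP[a1 /IH [g [Hg Lg]]]].
  exists 1; split=> [k _|]; first by rewrite !big_nil mul1r.
  case: n => [|n]; first by rewrite big_ord0.
  rewrite big_ord_recl coef1 normr1 expr1n big1 ?addr0 // => i _.
  by rewrite coef1 normr0 expr0n.
have [h [Hh Lh]] := blaschke_step n g a1.
exists h; split; last exact: le_trans Lh Lg.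
move=> k kn; rewrite !big_cons -(coef_mul_agree _ Hg) // [in RHS]mulrCA.
by rewrite -(coef_mul_agree _ Hh) // [in RHS]mulrCA mulrA.
Qed.

(** * Expanding polynomials are determined by the quotient by their reverse *)

Definition expanding_poly (R : realType) (p : {poly int}) : Prop :=
  [/\ p \is monic, `|p`_0| = 2
    & forall z : complex R, root (map_poly intr p) z -> 1 < `|z|].

Definition reverse (A : nzRingType) (d : nat) (p : {poly A}) : {poly A} :=
  \poly_(i < d.+1) p`_(d - i).

(** Both indices run over one square box, so that [rev_ord] can be applied to each of them
    separately. *)
Lemma coef_mul_box (A : comNzRingType) n (p q : {poly A}) m :
  (size p <= n)%N -> (size q <= n)%N ->
  (p * q)`_m = \sum_(i < n) \sum_(j < n | (i + j == m)%N) p`_i * q`_j.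
Proof.
move=> sp sq.
have E (r : {poly A}) : (size r <= n)%N -> r = \sum_(i < n) r`_i *: 'X^i.
  move=> sr; apply/polyP => k; rewrite coef_sum.
  have [kn|nk] := ltnP k n; last first.
    rewrite nth_default ?(leq_trans sr) // big1 // => i _.
    rewrite coefZ coefXn; case: eqP => [ki|]; last by rewrite mulr0.
    by move: (ltn_ord i); rewrite -ki ltnNge nk.
  rewrite (bigD1 (Ordinal kn)) //= coefZ coefXn eqxx mulr1 big1 ?addr0 // => i.
  by rewrite -val_eqE /= coefZ coefXn eq_sym => /negPf ->; rewrite mulr0.
rewrite {1}(E p sp) {1}(E q sq) mulr_suml coef_sum; apply: eq_bigr => i _.
rewrite mulr_sumr coef_sum [RHS]big_mkcond; apply: eq_bigr => j _.
rewrite -scalerAl -scalerAr scalerA -exprD coefZ coefXn eq_sym.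
by case: ifP => _; rewrite ?mulr1 ?mulr0.
Qed.

(** Substituting 1/x in p* q and multiplying by x^(2d) gives p q*. *)
Lemma coef_reverseM (A : comNzRingType) d (p q : {poly A}) k :
  (size p <= d.+1)%N -> (size q <= d.+1)%N -> (k <= d.*2)%N ->
  (reverse d p * q)`_(d.*2 - k) = (p * reverse d q)`_k.
Proof.
move=> sp sq kd.
rewrite !(@coef_mul_box _ d.+1) ?size_poly //.
rewrite (reindex_inj rev_ord_inj) /=; apply: eq_bigr => i _.
rewrite [RHS](reindex_inj rev_ord_inj) /=; apply: eq_big => j.
  by have := ltn_ord i; have := ltn_ord j; lia.
move=> _; rewrite !coef_poly !subSS.
have id := ltn_ord i; have jd := ltn_ord j.
by rewrite !ltnS !leq_subr !subKn.
Qed.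

Lemma reverse_prod_XsubC (A : comNzRingType) (s : seq A) :
  \prod_(b <- s) (1 - b%:P * 'X) = reverse (size s) (\prod_(b <- s) ('X - b%:P)).
Proof.
elim: s => [|b s IH].
  rewrite !big_nil; apply/polyP => k; rewrite coef1 coef_poly ltnS leqn0.
  by case: eqP => [->|//]; rewrite coef1.
rewrite !big_cons IH; set P := \prod_(j <- s) _.
have sP : size P = (size s).+1 by rewrite /P size_prod_XsubC.
apply/polyP => k; rewrite mulrBl mul1r coefB -mulrA coefCM coefXM !coef_poly.
rewrite mulrBl coefB coefCM coefXM.
case: k => [|k] /=; first by rewrite subn0 [P`_(size s).+1]nth_default ?sP // !mulr0.
rewrite !ltnS subSS subn_eq0.
have [ks|sk] := ltnP k (size s).
  by rewrite (ltnW ks) subnS.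
have [->|ks] := eqVneq k (size s); first by rewrite leqnn subnn !sub0r.
by rewrite leqNgt ltn_neqAle eq_sym ks sk /= mulr0 subr0.
Qed.

Section ExpandingPoly.
Variable R : realType.
Local Notation C := (complex R).
Implicit Types p q : {poly int}.
Local Notation toC := (map_poly (intr : int -> C)).

(** Integer coefficients make the multiset of roots stable under conjugation, which puts the reverse
    into the form of a Blaschke numerator. *)
Lemma expanding_poly_factor p d : expanding_poly R p -> size p = d.+1 ->
  exists s : seq C, [/\ toC p = \prod_(a <- s) ('X - a%:P), size s = d,
    all (fun a => 1 < `|a|) s
    & toC (reverse d p) = \prod_(a <- s) (1 - (a^*)%:P * 'X)].
Proof.
move=> [pm p0 proot] sp.
have [s Es] := closed_field_poly_normal (toC p).
have lc : lead_coef (toC p) = 1 by rewrite lead_coef_map_inj ?(monicP pm) //; exact: intr_inj.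
rewrite lc scale1r in Es.
have ss : size s = d.
  have := size_map_inj_poly (@intr_inj C) (rmorph0 _) p.
  by rewrite Es size_prod_XsubC sp => -[].
have Ec : toC p = \prod_(a <- [seq a^* | a <- s]) ('X - a%:P).
  have {1}<- : map_poly Num.conj (toC p) = toC p.
    by apply/polyP => i; rewrite !coef_map_id0 ?rmorph0 //= rmorph_int.
  rewrite big_map.
  rewrite Es rmorph_prod; apply: eq_bigr => a _.
  by rewrite rmorphB /= map_polyX map_polyC.
exists s; split=> //.
  apply/allP => a sa; apply: proot; rewrite Es.
  by rewrite root_prod_XsubC.
rewrite -(big_map (fun a : C => a^*) xpredT (fun a => 1 - a%:P * 'X)).
rewrite reverse_prod_XsubC -Ec size_map ss.
apply/polyP => i; rewrite coef_map [RHS]coef_poly /= coef_poly.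
by case: ifP => _; rewrite ?coef_map ?rmorph0.
Qed.

Lemma expanding_poly_series p d : expanding_poly R p -> size p = d.+1 ->
  exists c : {poly C},
    (forall k, (k < d)%N -> (toC p * c)`_k = (toC (reverse d p))`_k) /\
    \sum_(k < d) `|c`_k| ^+ 2 <= 1.
Proof.
move=> ep sp; have [s [-> _ s1 ->]] := expanding_poly_factor ep sp.
exact: blaschke_product.
Qed.

Lemma coef_mul_low (A : comNzRingType) (p q : {poly A}) h :
  (forall k, (k < h)%N -> q`_k = 0) -> (p * q)`_h = p`_0 * q`_h.
Proof.
move=> H; rewrite coefM big_ord_recl subn0 big1 ?addr0 // => i _.
by rewrite H ?mulr0 // lift0; have := ltn_ord i; lia.
Qed.

(** Below degree d the cross product p* q - q* p agrees with p q (c - c'), where c - c' has no term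
    below degree [h]. *)
Lemma reverse_cross_coef p q d (c c' : {poly C}) h :
  (forall k, (k < d)%N -> (toC p * c)`_k = (toC (reverse d p))`_k) ->
  (forall k, (k < d)%N -> (toC q * c')`_k = (toC (reverse d q))`_k) ->
  (h < d)%N -> (forall k, (k < h)%N -> c`_k = c'`_k) ->
  ((reverse d p * q - reverse d q * p)`_h)%:~R
    = (p`_0 * q`_0)%:~R * (c`_h - c'`_h).
Proof.
move=> Hc Hc' hd agree.
have -> : ((reverse d p * q - reverse d q * p)`_h)%:~R
   = (toC p * toC q * (c - c'))`_h.
  rewrite -coef_map_id0 ?rmorph0 // rmorphB !rmorphM /= coefB.
  have -> : (toC (reverse d p) * toC q)`_h = (toC q * (toC p * c))`_h.
    by rewrite mulrC -(coef_mul_agree _ Hc).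
  have -> : (toC (reverse d q) * toC p)`_h = (toC p * (toC q * c'))`_h.
    by rewrite mulrC -(coef_mul_agree _ Hc').
  by rewrite -coefB; congr (nth _ (polyseq _) _); ring.
rewrite coef_mul_low; last by move=> k kh; rewrite coefB agree ?subrr.
by rewrite coef0M !coef_map /= intrM coefB.
Qed.

(** The cross product [T] vanishes below degree d because the series agree, and above it by
    antisymmetry under k -> 2d - k, which also makes its middle coefficient its own opposite. So p*
    q = q* p. The roots of p lie outside the closed unit disc and those of p* inside it, so p
    divides q, and both are monic of one degree. *)
Lemma expanding_poly_determined p q d (c c' : {poly C}) :
  expanding_poly R p -> expanding_poly R q -> size p = d.+1 -> size q = d.+1 ->
  (forall k, (k < d)%N -> (toC p * c)`_k = (toC (reverse d p))`_k) ->
  (forall k, (k < d)%N -> (toC q * c')`_k = (toC (reverse d q))`_k) ->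
  (forall k, (k < d)%N -> c`_k = c'`_k) -> p = q.
Proof.
move=> ep eq sp sq Hc Hc' agree.
set T := reverse d p * q - reverse d q * p.
have Tlow k : (k < d)%N -> T`_k = 0.
  move=> kd; apply: (@intr_inj C); rewrite (reverse_cross_coef Hc Hc') //.
    by rewrite agree // subrr mulr0.
  by move=> j jk; apply: agree; exact: ltn_trans kd.
have Tanti k : (k <= d.*2)%N -> T`_(d.*2 - k) = - T`_k.
  move=> kd; rewrite /T !coefB !coef_reverseM ?sp ?sq // opprB.
  by rewrite mulrC [q * _]mulrC.
have sT : (size T <= d.*2.+1)%N.
  have sz (a b : {poly int}) : (size a <= d.+1)%N -> (size b <= d.+1)%N ->
      (size (a * b)%R <= d.*2.+1)%N.
    move=> sa sb; apply: leq_trans (size_polyMleq _ _) _.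
    by move: sa sb; lia.
  rewrite (leq_trans (size_polyD _ _)) // size_polyN geq_max.
  by rewrite !sz ?size_poly ?sp ?sq.
have T0 : T = 0.
  apply/polyP => k; rewrite coef0.
  have [kd|dk] := ltnP k d; first exact: Tlow.
  have [kd|dk2] := leqP k d.*2; last by rewrite nth_default // (leq_trans sT).
  have := Tanti (d.*2 - k)%N; rewrite subKn // leq_subr => /(_ isT) ->.
  have [ke|ke] := eqVneq k d; last by rewrite Tlow ?oppr0 //; lia.
  have dd : (d.*2 - d)%N = d by rewrite -addnn addnK.
  have := Tanti d; rewrite ke dd -addnn leq_addr => /(_ isT).
  by set x := T`_d; lia.
have [s [Ep _ s1 Er]] := expanding_poly_factor ep sp.
have cop : coprimep (toC p) (toC (reverse d p)).
  apply/Pdiv.ClosedField.coprimepP => z; rewrite Ep root_prod_XsubC => zs.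
  rewrite Er horner_prod prodf_seq_neq0; apply/allP => a as_ /=; rewrite !hornerE.
  apply/eqP => /eqP; rewrite subr_eq0 => /eqP /(congr1 Num.norm).
  rewrite normr1 normrM norm_conjC => e1.
  have : 1 < `|a| * `|z| by rewrite mulr_egt1 ?(allP s1).
  by rewrite -e1 ltxx.
have dv : toC p %| toC q.
  rewrite -(Gauss_dvdpr _ cop) -rmorphM /=.
  by move/eqP: T0; rewrite subr_eq0 => /eqP ->; rewrite rmorphM dvdp_mull.
have [pm _ _] := ep; have [qm _ _] := eq.
apply: (map_inj_poly (@intr_inj C) (rmorph0 _)).
apply/eqP; rewrite -eqp_monic ?monic_map //.
have szC (r : {poly int}) : size (toC r) = size r.
  by rewrite size_map_inj_poly ?rmorph0 //; exact: intr_inj.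
by rewrite -(dvdp_size_eqp dv) !szC sp sq.
Qed.
End ExpandingPoly.

(** * Encoding expanding polynomials by tuples of naturals *)

Section CosetIndex.
Variable R : realType.

(** [Negz n] is - n - 1, so the preimages of [n] are n and - n - 1, which have opposite parity. *)
Definition zigzag (m : int) : nat := match m with Posz n => n | Negz n => n end.

(* Numbers the points of a coset of [Z] in a way that is monotone in the absolute
   value, alternating between the two sides of 0. *)
Definition coset_index (x : R) : nat := zigzag (Num.floor (2 * x)).

Lemma coset_index_sq (x : R) : (coset_index x)%:R ^+ 2 <= 4 * x ^+ 2.
Proof.
have /andP[] := floor_itv (2 * x); rewrite /coset_index.
case: (Num.floor (2 * x)) => n /= l u.
  have n0 : 0 <= n%:R :> R by [].
  by rewrite -pmulrn in l; nra.
have n0 : 0 <= n%:R :> R by [].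
have e : (Negz n + 1)%:~R = - n%:R :> R.
  by rewrite NegzE -addn1 PoszD opprD subrK mulrNz.
by rewrite e in u; nra.
Qed.

(** The floors of 2 x and 2 y differ by the even number 2 m, while distinct integers with one
    [zigzag] value differ by an odd number. *)
Lemma coset_index_inj (x y : R) (m : int) : x - y = m%:~R -> coset_index x = coset_index y -> m = 0.
Proof.
move=> xy; have -> : x = y + m%:~R by rewrite -xy addrC subrK.
rewrite /coset_index mulrDr; have -> : 2 * m%:~R = (2 * m)%:~R :> R by rewrite intrM.
rewrite floorDrz ?intr_int // intrKfloor.
have Z (a : int) : (zigzag a)%:Z = if 0 <= a then a else - a - 1.
  by case: a => n //=; lia.
move=> /(congr1 Posz); rewrite !Z; move: (Num.floor _) {xy} => t.
by do 2 case: ifP; lia.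
Qed.

End CosetIndex.

Section Signature.
Variables (R : realType) (d : nat).
Local Notation C := (complex R).
Local Notation toC := (map_poly (intr : int -> C)).

Definition expanding_poly_of_degree (p : {poly int}) : Prop :=
  expanding_poly R p /\ size p = d.+1.

Lemma expanding_poly_signature : (0 < d)%N ->
  exists f : {poly int} -> bool * {ffun 'I_d.-1 -> 'I_7},
    (forall p q, expanding_poly_of_degree p -> expanding_poly_of_degree q ->
       f p = f q -> p = q) /\
    (forall p, expanding_poly_of_degree p -> (\sum_i (f p).2 i ^ 2 <= 48)%N).
Proof.
move=> d0.
have ReB (x y : C) : complex.Re (x - y) = complex.Re x - complex.Re y by case: x y => [? ?] [].
have ReZ (r : R) (z : C) : complex.Re (r%:C%C * z) = r * complex.Re z.
  by case: z => a b /=; rewrite mul0r subr0.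
have /choice [c Hc] : forall p, exists c : {poly C}, expanding_poly_of_degree p ->
    (forall k, (k < d)%N -> (toC p * c)`_k = (toC (reverse d p))`_k) /\
    \sum_(k < d) `|c`_k| ^+ 2 <= 1.
  move=> p; have [[ep sp]|np] := pselect (expanding_poly_of_degree p); last by exists 0 => /np.
  by have [c] := expanding_poly_series ep sp; exists c.
(* Differences of coefficients will lie in Z/4, whence the factor 4; the index is shifted because
   c_0 = 1 / p_0 is fixed by the sign of p_0. *)
pose e p (i : nat) := coset_index (4 * complex.Re (c p)`_i.+1).
have c0 p : expanding_poly_of_degree p -> (p`_0)%:~R * (c p)`_0 = 1.
  move=> okp; have [/(_ 0%N d0) + _] := Hc p okp; case: okp => -[pm _ _] sp.
  rewrite coef0M coef_map /= => ->.
  by rewrite coef_map /= coef_poly /= subn0 -[d]/(d.+1.-1) -sp -lead_coefE (monicP pm).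
have sum_e p : expanding_poly_of_degree p -> (\sum_(i < d.-1) e p i ^ 2 <= 48)%N.
  move=> okp; have [_] := Hc p okp; have c0p := c0 p okp.
  case: okp => -[_ p0 _] _.
  have n0 : `|(c p)`_0| ^+ 2 = 4^-1.
    have := congr1 (fun x => `|x| ^+ 2) c0p.
    rewrite normrM exprMn -intr_norm p0 normr1 expr1n => e1.
    apply: (@mulfI _ 4); rewrite ?pnatr_eq0 // divff ?pnatr_eq0 //.
    by rewrite -[RHS]e1 -[(2 : int)%:~R]/(2%:R) -natrX.
  have -> : \sum_(k < d) `|(c p)`_k| ^+ 2
      = 4^-1 + \sum_(i < d.-1) `|(c p)`_i.+1| ^+ 2.
    by case: (d) d0 => // d' _; rewrite big_ord_recl n0.
  move=> H.
  have : 4^-1 + \sum_(i < d.-1) complex.Re (c p)`_i.+1 ^+ 2 <= 1 :> R.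
    rewrite -(lecR _ 1) (le_trans _ H) // rmorphD fmorphV rmorph_nat rmorph_sum.
    rewrite lerD2l ler_sum // => i _; rewrite -add_Re2_Im2 lecR lerDl.
    exact: sqr_ge0.
  move=> H1.
  rewrite -(ler_nat R) natr_sum.
  (* A squared index is at most 4 (4 Re c)^2 = 64 (Re c)^2, and the real parts past c_0 have square
     sum at most 3/4, which gives 48. *)
  apply: le_trans (_ : \sum_(i < d.-1) 64 * complex.Re (c p)`_i.+1 ^+ 2 <= _).
    apply: ler_sum => i _; rewrite natrX (le_trans (coset_index_sq _)) // exprMn.
    lra.
  by rewrite -mulr_sumr; lra.
(* Every entry stays below 7 because 7^2 > 48. *)
have e_lt p i : expanding_poly_of_degree p -> (i < d.-1)%N -> (e p i < 7)%N.
  move=> okp id; have := sum_e p okp; rewrite (bigD1 (Ordinal id)) //=.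
  by move: (e p i) => x; move: (\sum_(_ < _ | _) _)%N => y; nia.
exists (fun p : {poly int} => (0 < p`_0, [ffun i : 'I_d.-1 => inord (e p i)])); split.
  move=> p q okp okq [sg /ffunP ee].
  have [Hcp _] := Hc p okp; have [Hcq _] := Hc q okq.
  have c0p := c0 p okp; have c0q := c0 q okq.
  case: (okp) (okq) => ep sp [eq sq].
  have pq0 : p`_0 = q`_0.
    have [_ hp _] := ep; have [_ hq _] := eq; move: sg hp hq.
    by move: (p`_0) (q`_0) => x y; case: (ltrgt0P x); case: (ltrgt0P y); lia.
  apply: (expanding_poly_determined ep eq sp sq Hcp Hcq).
  elim/ltn_ind=> -[_ _|k IH kd].
    have p0 : (p`_0)%:~R != 0 :> C by rewrite intr_eq0; case: ep => _ + _; lia.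
    by apply: (mulfI p0); rewrite c0p pq0 c0q.
  have agree j : (j < k.+1)%N -> (c p)`_j = (c q)`_j.
    by move=> jk; apply: IH => //; exact: ltn_trans kd.
  (* At the first index still open, 4 times the difference of the coefficients is the integer [m],
     since p_0 q_0 = p_0^2 = 4. *)
  have := reverse_cross_coef Hcp Hcq kd agree.
  set m := (X in X%:~R); rewrite -pq0 (_ : p`_0 * p`_0 = 4); last first.
    by case: ep => _ + _; nia.
  move=> mE; have kd' : (k < d.-1)%N by lia.
  have := ee (Ordinal kd'); rewrite !ffunE /= => /(congr1 val) /=.
  rewrite !inordK ?e_lt // => /(@coset_index_inj _ _ _ m) m0.
  have m00 : m = 0.
    apply: m0; rewrite -mulrBr -ReB.
    move/(congr1 (@complex.Re R)): mE.
    rewrite -(rmorph_int (real_complex R)) -(rmorph_int (real_complex R) 4) ReZ.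
    by rewrite /= => ->.
  apply/eqP; rewrite -subr_eq0; move/eqP: mE; rewrite m00 eq_sym mulf_eq0.
  by rewrite intr_eq0 => /orP[].
move=> p okp; rewrite (eq_bigr (fun i : 'I_d.-1 => e p i ^ 2)%N) ?sum_e // => i _.
by rewrite ffunE /= inordK ?e_lt.
Qed.

End Signature.

(** * Counting the signatures *)

Section Counting.
Variable n : nat.

Lemma card_signatures_le : (#|{: bool * {ffun 'I_n -> 'I_7}}| = 2 * 7 ^ n)%N.
Proof. by rewrite card_prod card_bool card_ffun !card_ord. Qed.

(* Each tuple is counted with the weight [(3/2)^(48 - sum of squares) >= 1]. *)
Lemma card_signatures_exp (R : realType) :
  #|[set f : bool * {ffun 'I_n -> 'I_7} | (\sum_i f.2 i ^ 2 <= 48)%N]%SET|%:R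
    <= 2 ^+ n.+1 * (3 / 2) ^+ 48 :> R.
Proof.
pose y : R := 2 / 3.
have y0 : 0 < y by rewrite /y; lra.
have y1 : y <= 1 by rewrite /y; lra.
have xy : (3 / 2 : R) = y^-1 by rewrite /y invf_div.
rewrite xy exprVn ler_pdivlMr ?exprn_gt0 //.
rewrite -sum1_card natr_sum mulr_suml.
apply: (@le_trans _ _ (\sum_(f : bool * {ffun 'I_n -> 'I_7}) \prod_i y ^+ (f.2 i ^ 2))).
  rewrite [leRHS](bigID (mem
    [set f : bool * {ffun 'I_n -> 'I_7} | (\sum_i f.2 i ^ 2 <= 48)%N]%SET)) /=.
  rewrite -[leLHS]addr0 lerD //; last first.
    by apply: sumr_ge0 => f _; apply: prodr_ge0 => i _; rewrite exprn_ge0 // ltW.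
  apply: ler_sum => f; rewrite inE => sf; rewrite mul1r prodrXr.
  by rewrite ler_wiXn2l // ltW.
rewrite -(pair_bigA _ (fun (_ : bool) (g : {ffun 'I_n -> 'I_7}) => \prod_i y ^+ (g i ^ 2))) /=.
rewrite sumr_const card_bool -[leLHS]mulr_natl exprS ler_wpM2l //.
(* The total weight is a power of the sum of (2/3)^(j^2) over j < 7, which is below 2. *)
rewrite -(bigA_distr_bigA (fun (_ : 'I_n) (j : 'I_7) => y ^+ (j ^ 2))).
rewrite prodr_const card_ord lerXn2r ?nnegrE //.
  by apply: sumr_ge0 => j _; rewrite exprn_ge0 // ltW.
rewrite !big_ord_recr big_ord0 /= /y; lra.
Qed.
End Counting.

(** * Numerical estimates for the upper bound *)

Section Numeric.
Variable R : realType.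

Lemma le_powR2 (x : R) m n : (0 < n)%N -> 0 <= x -> x ^+ n <= 2 ^+ m ->
  x <= 2 `^ (m%:R / n%:R).
Proof.
move=> n0 x0 H; rewrite -(@ler_pXn2r _ n) ?nnegrE ?powR_ge0 //.
by rewrite -[leRHS]powR_mulrn ?powR_ge0 // -powRrM mulfVK ?powR_mulrn // pnatr_eq0 -lt0n.
Qed.

(** From 1 - u/n <= exp(- u/n) the hypothesis gives 1/t <= exp(- u); this reduces a lower bound for
    a logarithm to rational arithmetic. *)
Lemma ln_ge_of_expr (t u : R) n : (0 < n)%N -> 0 < t -> u <= n%:R ->
  t^-1 <= (1 - u / n%:R) ^+ n -> u <= ln t.
Proof.
move=> n0 t0 un H.
have n0' : 0 < n%:R :> R by rewrite ltr0n.
rewrite -ler_expR lnK ?posrE // -[leLHS]invrK -expRN.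
rewrite -[leRHS]invrK lef_pV2 ?posrE ?invr_gt0 ?expR_gt0 //.
rewrite (le_trans H) // -[X in expR X](divfK (lt0r_neq0 n0')) expRM_natr.
rewrite lerXn2r ?nnegrE ?expR_ge0 ?subr_ge0 ?ler_pdivrMr ?mul1r //.
by rewrite mulNr; exact: expR_ge1Dx.
Qed.

(** Follows from ln u >= 1 - 1/u. *)
Lemma lnln_ge (u k : R) : 0 < u -> 0 <= k -> k * u ^+ 2 <= u - 1 ->
  k <= ln u / u.
Proof.
move=> u0 k0 H; rewrite ler_pdivlMr //.
have lnu : 1 - u^-1 <= ln u.
  have v0 : 0 < u^-1 by rewrite invr_gt0.
  have /le_ln1Dx : -1 < u^-1 - 1 by lra.
  by rewrite (_ : 1 + (u^-1 - 1) = u^-1) ?lnV ?posrE //; lra.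
suff : k * u <= 1 - u^-1 by lra.
by rewrite -(ler_pM2r u0) mulrBl mulVf ?gt_eqF // mul1r -mulrA -expr2.
Qed.

(** The ratio ln ln d / ln d is at least 29/384 for d = 3 and 29/256 for 4 <= d <= 15, so the
    exponent is at least 53/8, respectively 45 d / 16. These suffice because 98^8 <= 2^53 and 7^16
    <= 2^45. *)
Lemma upper_bound_small d : (3 <= d <= 15)%N ->
  (2 * 7 ^ d.-1)%:R <= 2 `^ (d%:R * (1 + 16 * ln (ln d%:R) / ln d%:R)) :> R.
Proof.
move=> /andP[d3 d15].
have [->|d4] := eqVneq d 3%N.
  have u1 : 109 / 100 <= ln 3%:R :> R.
    apply: (@ln_ge_of_expr _ _ 128) => //; first by lra.
    set x : R := 1 - _.
    have x1 : (991 + 484 / 1000) / 1000 <= x by rewrite /x; lra.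
    have sq (a b c : R) : 0 <= a -> a <= b -> c <= a ^+ 2 -> c <= b ^+ 2.
      by move=> a0 ab ca; nra.
    (* The 128th power is taken as seven squarings, with the value rounded down before each. *)
    rewrite (_ : 128 = 2 * 2 * 2 * 2 * 2 * 2 * 2)%N // !exprM.
    have x2 : (983 + 40 / 1000) / 1000 <= x ^+ 2 by apply: sq x1 _; lra.
    have x3 : (966 + 360 / 1000) / 1000 <= (x ^+ 2) ^+ 2 by apply: sq x2 _; lra.
    have x4 : (933 + 850 / 1000) / 1000 <= ((x ^+ 2) ^+ 2) ^+ 2 by apply: sq x3 _; lra.
    have x5 : (872 + 70 / 1000) / 1000 <= (((x ^+ 2) ^+ 2) ^+ 2) ^+ 2 by apply: sq x4 _; lra.
    have x6 : (760 + 500 / 1000) / 1000 <= ((((x ^+ 2) ^+ 2) ^+ 2) ^+ 2) ^+ 2.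
      by apply: sq x5 _; lra.
    have x7 : (578 + 360 / 1000) / 1000 <= (((((x ^+ 2) ^+ 2) ^+ 2) ^+ 2) ^+ 2) ^+ 2.
      by apply: sq x6 _; lra.
    by apply: sq x7 _; lra.
  have u2 : ln 3%:R <= 3 :> R by apply/ltW/ln_sublinear.
  apply: le_trans (_ : 2 `^ (53%:R / 8%:R) <= _).
    apply: le_powR2 => //.
    have -> : (2 * 7 ^ 3.-1)%:R = 98 :> R by [].
    lra.
  apply: ler_powR; first by lra.
  have k : 29 / 384 <= ln (ln 3%:R) / ln 3%:R :> R by apply: lnln_ge; nra.
  by move: k; rewrite -(mulrA 16); set g := ln _ / ln _; lra.
have {d3 d4}d4 : (4 <= d)%N by lia.
have d0 : 0 < d%:R :> R by rewrite ltr0n; lia.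
have u1 : 5 / 4 <= ln d%:R :> R.
  apply: (@le_trans _ _ (ln 4%:R)); last by rewrite ler_ln ?posrE ?ler_nat.
  apply: (@ln_ge_of_expr _ _ 8) => //; first by lra.
  set x : R := 1 - _; have -> : x = 27 / 32 by rewrite /x; lra.
  lra.
have u2 : ln d%:R <= 4 :> R.
  apply: (@le_trans _ _ (ln (2 ^+ 4))).
    by rewrite ler_ln ?posrE ?exprn_gt0 // -natrX ler_nat; lia.
  rewrite lnXn //; have := @ln_sublinear R 2; have := @le_ln1Dx R 1; lra.
apply: le_trans (_ : 2 `^ ((45 * d)%:R / 16%:R) <= _).
  apply: le_powR2 => //; rewrite natrM natrX exprMn -exprM.
  have -> : (45 * d = 45 + 45 * d.-1)%N by lia.
  rewrite exprD (mulnC d.-1) (exprM 7) (exprM 2) ler_pM ?exprn_ge0 //; first by lra.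
  by rewrite lerXn2r ?nnegrE ?exprn_ge0 //; lra.
apply: ler_powR; first by lra.
have k : 29 / 256 <= ln (ln d%:R) / ln d%:R :> R by apply: lnln_ge; nra.
by move: k; rewrite -(mulrA 16) natrM; set g := ln _ / ln _; nra.
Qed.

(** Here (3/2)^48 <= 2^32, and the additional exponent 16 d ln ln d / ln d is at least 32, since ln
    ln d >= 1/2 and ln d <= d/4. *)
Lemma upper_bound_large d : (16 <= d)%N ->
  2 ^+ d * (3 / 2) ^+ 48 <= 2 `^ (d%:R * (1 + 16 * ln (ln d%:R) / ln d%:R)) :> R.
Proof.
move=> d16.
have dR : 16 <= d%:R :> R by rewrite (ler_nat _ 16).
have d0 : 0 < d%:R :> R by lra.
have l2 : ln 2 <= 1 :> R by have := @le_ln1Dx R 1; lra.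
have l2' : 1 / 2 <= ln 2 :> R by apply: (@ln_ge_of_expr _ _ 1) => //; lra.
have l16 : ln 16%:R = ln 2 *+ 4 :> R by rewrite -lnXn // -natrX.
have u1 : 2 <= ln d%:R :> R.
  apply: (@le_trans _ _ (ln 16%:R)); last by rewrite ler_ln ?posrE.
  by rewrite l16; lra.
have u2 : ln d%:R <= d%:R / 4 :> R.
  have := @le_ln1Dx R (d%:R / 16 - 1).
  rewrite (_ : 1 + (d%:R / 16 - 1) = d%:R / 16%:R); last by rewrite addrC subrK.
  by rewrite ln_div ?posrE // l16; lra.
have v : 1 / 2 <= ln (ln d%:R) :> R.
  have /ler_pM2l <- : 0 < (ln d%:R)^-1 :> R by rewrite invr_gt0; lra.
  rewrite [leRHS]mulrC; apply: lnln_ge; first by lra.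
    by rewrite mulr_ge0 ?invr_ge0; lra.
  have un0 : ln d%:R != 0 :> R by rewrite gt_eqF; lra.
  have -> : (ln d%:R)^-1 * (1 / 2) * ln d%:R ^+ 2 = ln d%:R / 2 :> R by field.
  lra.
apply: (@le_trans _ _ (2 `^ ((d + 32)%:R))).
  rewrite powR_mulrn // exprD ler_pM2l ?exprn_gt0 //; lra.
apply: ler_powR; first by lra.
rewrite natrD mulrDr mulr1 lerD2l -mulrA.
set u := ln d%:R in u1 u2 v *.
have u0 : 0 < u by lra.
have -> : d%:R * (16 * (ln u / u)) = (d%:R * 16 * ln u) / u by rewrite !mulrA.
by rewrite ler_pdivlMr //; nra.
Qed.
End Numeric.

(** * Characteristic polynomials and cyclic vectors *)

Section CharPoly.
Variable R : realType.
Local Notation C := (complex R).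
Local Notation toC := (map_poly (intr : int -> C)).
Local Notation toQ := (map_poly (intr : int -> rat)).
Implicit Types p q : {poly int}.

Lemma admissible_char_poly d (M : 'M[int]_d) d0 d1 : admissible R M d0 d1 ->
  expanding_poly_of_degree R d (char_poly M).
Proof.
move=> [ex dM _]; split; last exact: size_char_poly.
split; first exact: char_poly_monic.
  by rewrite char_poly_det normrM normr_sign mul1r.
by move=> z; rewrite map_char_poly -eigenvalue_root_char => /ex.
Qed.

(** Up to sign, the constant term of f is its leading coefficient ±1 times the product of its roots,
    and these are roots of p. *)
Lemma expanding_poly_factor_gt1 p f g : expanding_poly R p -> p = f * g ->
  (1 < size f)%N -> 1 < `|f`_0|.
Proof.
move=> [pm p0 pr] pfg sf.
have f0 : f != 0 by rewrite -size_poly_gt0; exact: ltn_trans sf.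
have [s Es] := closed_field_poly_normal (toC f).
have szf : size (toC f) = size f.
  by rewrite size_map_inj_poly ?rmorph0 //; exact: intr_inj.
have lcu : lead_coef f * lead_coef g = 1 by rewrite -lead_coefM -pfg (monicP pm).
have lc : `|lead_coef (toC f)| = 1.
  rewrite lead_coef_map_inj ?rmorph0 //; last exact: intr_inj.
  rewrite -intr_norm; suff -> : `|lead_coef f| = 1 by [].
  move/(congr1 absz): lcu; rewrite abszM => /eqP; rewrite muln_eq1 => /andP[/eqP e _].
  by rewrite -abszE e.
have ss : (0 < size s)%N.
  move: szf; rewrite Es size_scale ?size_prod_XsubC; last first.
    by rewrite -normr_gt0 lc.
  by move=> e; move: sf; rewrite -e.
have s1 : {in s, forall a, 1 < `|a|}.
  move=> a as_; apply: pr; rewrite pfg rmorphM rootM /= Es rootZ ?root_prod_XsubC ?as_ //.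
  by rewrite -normr_gt0 lc.
have : `|(f`_0)%:~R| = \prod_(a <- s) `|a| :> C.
  rewrite -[(f`_0)%:~R](coef_map (intr : {rmorphism int -> C})) -horner_coef0 Es hornerZ.
  rewrite normrM lc mul1r horner_prod normr_prod.
  by apply: eq_bigr => a _; rewrite !hornerE normrN.
rewrite -intr_norm => e; rewrite -(ltr_int C) e.
case: s ss s1 {Es e} => // a s _ s1; rewrite big_cons.
apply: (@lt_le_trans _ _ `|a|); first by apply: s1; rewrite mem_head.
rewrite ler_peMr // big_seq; elim/big_ind: _ => // [x y x1 y1|b bs].
  by rewrite mulr_ege1.
by apply/ltW/s1; rewrite in_cons bs orbT.
Qed.

(** A rational factorization rescales to an integer one; two nonconstant factors would have constant
    terms of modulus at least 2 whose product is ±2. *)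
Lemma expanding_poly_irreducible p : expanding_poly R p -> irreducible_poly (toQ p).
Proof.
move=> ep; have [pm p0 _] := ep.
have szQ q : size (toQ q) = size q.
  by rewrite size_map_inj_poly ?rmorph0 //; exact: intr_inj.
split.
  rewrite szQ ltnNge; apply/negP => /size1_polyC pC.
  by move: pm p0; rewrite pC monicE lead_coefC coefC /= => /eqP ->.
move=> g sg /dvdpP_rat_int [f [a a0 gE] [r pfr]]; move: sg; rewrite {}gE => sg.
have pn0 : p != 0 by apply: monic_neq0.
have fn0 : f != 0 by apply: contraNneq pn0; rewrite pfr => ->; rewrite mul0r.
have sf : (1 < size f)%N.
  move: sg; rewrite size_scale // szQ ltn_neqAle eq_sym => -> /=.
  by rewrite size_poly_gt0.
apply: (eqp_trans (eqp_scale _ a0)).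
have sr : (size r <= 1)%N.
  rewrite leqNgt; apply/negP => sr.
  have := expanding_poly_factor_gt1 ep pfr sf.
  have := expanding_poly_factor_gt1 ep (etrans pfr (mulrC _ _)) sr.
  by move: p0; rewrite pfr coef0M; move: (f`_0) (r`_0) => x y; nia.
rewrite pfr [r]size1_polyC // rmorphM /= map_polyC mulrC mul_polyC eqp_sym eqp_scale //.
rewrite intr_eq0; apply: contraNneq pn0 => r0.
by rewrite pfr [r]size1_polyC // r0 mulr0.
Qed.

Lemma horner_mx_sum (A : comNzRingType) n (M : 'M[A]_n.+1) (p : {poly A}) m :
  (size p <= m)%N -> horner_mx M p = \sum_(i < m) p`_i *: M ^+ i.
Proof.
move=> sp.
have {1}-> : p = \sum_(i < m) p`_i *: 'X^i.
  rewrite -poly_def; apply/polyP => k; rewrite coef_poly; case: ltnP => // mk.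
  by rewrite nth_default // (leq_trans sp).
rewrite linear_sum; apply: eq_bigr => i _.
by rewrite linearZ /= rmorphXn /= horner_mx_X.
Qed.

Lemma horner_mx_mulVec (A : comNzRingType) n (M : 'M[A]_n.+1) (p : {poly A})
    (v : 'cV_n.+1) m :
  (size p <= m)%N -> horner_mx M p *m v = \sum_(i < m) p`_i *: (M ^+ i *m v).
Proof.
move=> sp; rewrite (horner_mx_sum _ sp) mulmx_suml.
by apply: eq_bigr => i _; rewrite scalemxAl.
Qed.

Section Cyclic.
Variables (n : nat) (M : 'M[int]_n.+1) (e : 'cV[int]_n.+1).
Hypotheses (ep : expanding_poly R (char_poly M)) (e0 : e != 0).

(** The remainder of [h] modulo [char_poly M] still kills [e]. A nonzero remainder would be coprime
    over the rationals to the irreducible characteristic polynomial, and Bezout would give e = 0. *)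
Lemma char_poly_annihilator h : horner_mx M h *m e = 0 ->
  exists q, h = q * char_poly M.
Proof.
move=> he; have [pm _ _] := ep.
have hE := Pdiv.RingMonic.rdivp_eq pm h.
set q := Pdiv.CommonRing.rdivp _ _ in hE; set r := Pdiv.CommonRing.rmodp _ _ in hE.
have szr : (size r < size (char_poly M))%N.
  by rewrite Pdiv.CommonRing.ltn_rmodp monic_neq0.
exists q; suff r0 : r = 0 by rewrite {1}hE r0 addr0.
have re : horner_mx M r *m e = 0.
  move: he; rewrite {1}hE rmorphD rmorphM /= Cayley_Hamilton.
  by rewrite [_ * 0]mulr0 add0r.
apply: contraNeq e0 => rn0.
have szQ q' : size (toQ q') = size q'.
  by rewrite size_map_inj_poly ?rmorph0 //; exact: intr_inj.
have : coprimep (toQ (char_poly M)) (toQ r).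
  rewrite irreducible_poly_coprime; last exact: expanding_poly_irreducible.
  apply: contraTN szr => /dvdp_leq; rewrite !szQ -leqNgt; apply.
  by rewrite -size_poly_eq0 szQ size_poly_eq0.
move=> /Bezout_eq1_coprimepP [[u v] /= uv].
pose MQ := map_mx (intr : int -> rat) M; pose eQ := map_mx (intr : int -> rat) e.
have eQ0 : eQ = 0.
  rewrite -[eQ]mul1mx idmxE -(rmorph1 (horner_mx MQ)) -uv rmorphD !rmorphM /=.
  rewrite /MQ -!(map_horner_mx (intr : {rmorphism int -> rat})) Cayley_Hamilton.
  rewrite map_mx0 [_ * 0]mulr0 add0r -[_ * _]/(_ *m _) -mulmxA -map_mxM re.
  by rewrite map_mx0 mulmx0.
apply/eqP/matrixP => i j; move/matrixP/(_ i j): eQ0; rewrite !mxE => /eqP.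
by rewrite intr_eq0 => /eqP.
Qed.

Definition krylov (A : pzRingType) (N : 'M[A]_n.+1) (v : 'cV[A]_n.+1) : 'M[A]_n.+1 :=
  \matrix_(i, j) (N ^+ j *m v) i 0.

(** A linear relation between the columns is a polynomial of degree at most n killing [e], hence a
    multiple of a polynomial of degree n + 1, hence 0. *)
Lemma krylov_unit : krylov (map_mx intr M : 'M[R]_n.+1) (map_mx intr e) \in unitmx.
Proof.
have -> : krylov (map_mx intr M : 'M[R]_n.+1) (map_mx intr e) = map_mx intr (krylov M e).
  apply/matrixP => i j; rewrite !mxE rmorph_sum; apply: eq_bigr => k _.
  rewrite rmorphM /= !mxE; congr (_ * _).
  by rewrite -(rmorphXn (map_mx (intr : {rmorphism int -> R}))) mxE.
rewrite unitmxE det_map_mx unitfE intr_eq0 -det_tr.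
apply/negP => /det0P [v vn0 vK].
pose h := rVpoly v.
have he : horner_mx M h *m e = 0.
  rewrite (horner_mx_mulVec _ _ (size_poly _ _)); apply/matrixP => i j.
  rewrite ord1 summxE; move/matrixP/(_ 0 i): vK; rewrite !mxE => vK.
  rewrite -[RHS]vK; apply: eq_bigr => k _; rewrite coef_rVpoly_ord.
  by rewrite !mxE.
have [q hq] := char_poly_annihilator he.
have h0 : h = 0.
  apply/eqP/negPn/negP => hn0.
  have := size_poly n.+1 (fun k => if insub k is Some i then v 0 i else 0).
  rewrite -/(rVpoly v) -/h hq size_Mmonic ?char_poly_monic //.
    rewrite size_char_poly; case: (eqVneq q 0) => [q0|]; last first.
      rewrite -size_poly_gt0; case: (size q) => [|k] _ //.
      by rewrite addSn /= addnS ltnNge leq_addl.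
    by move: hn0; rewrite hq q0 mul0r eqxx.
  by apply: contraNneq hn0; rewrite hq => ->; rewrite mul0r.
by move: vn0; rewrite -[v]rVpolyK -/h h0 linear0 eqxx.
Qed.
End Cyclic.
End CharPoly.

(** * Decay of inverse powers *)

Section Decay.

(* Removes the linear factors of an annihilating polynomial one at a time. *)
Lemma inverse_powers_decay_complex (F : numClosedFieldType) n
    (A N : 'M[F]_n.+1) (r : F) (s : seq F) :
  N *m A = 1%:M -> 0 < r -> all (fun a => 1 < `|a| * r) s ->
  forall w : 'cV[F]_n.+1, horner_mx A (\prod_(a <- s) ('X - a%:P)) *m w = 0 ->
  exists2 K, 0 <= K & forall k i, `|(N ^+ k *m w) i 0| <= K * r ^+ k.
Proof.
move=> NA r0; elim: s => [_ w|a s IH /= /andP[a1 /IH{}IH] w].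
  rewrite big_nil rmorph1 mul1mx => ->; exists 0 => // k i.
  by rewrite mulmx0 mxE normr0 mul0r.
rewrite big_cons mulrC rmorphM /= -[_ * _]/(_ *m _) -mulmxA => /IH [K' K'0 HK'].
have a0 : 0 < `|a|.
  by rewrite lt0r normr_ge0 andbT; apply: contraTneq a1 => ->; rewrite mul0r ltr10.
have ar0 : 0 < `|a| * r - 1 by rewrite subr_gt0.
set w' := horner_mx A ('X - a%:P) *m w in HK'.
have step k : N ^+ k.+1 *m w = a^-1 *: (N ^+ k *m w - N ^+ k.+1 *m w').
  rewrite /w' rmorphB /= horner_mx_X horner_mx_C mulmxBl mulmxBr.
  rewrite {2}exprSr -[N ^+ k * N]/(_ *m _) -!mulmxA (mulmxA N A) NA mul1mx opprB addrC subrK.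
  by rewrite mul_scalar_mx -!scalemxAr scalerA mulVf ?scale1r // -normr_gt0.
(* The second summand is the [D] with D (|a| r - 1) = K' r, which makes the bound stable under the
   recursion [step]. *)
exists (\sum_i `|w i 0| + K' * r / (`|a| * r - 1)).
  by rewrite addr_ge0 ?sumr_ge0 // divr_ge0 ?mulr_ge0 // ltW.
set W := \sum_i _; set D := K' * r / _.
have W0 : 0 <= W by rewrite sumr_ge0.
have D0 : 0 <= D by rewrite divr_ge0 ?mulr_ge0 // ltW.
have DE : K' * r = D * (`|a| * r - 1) by rewrite /D divfK ?gt_eqF.
elim=> [|k IHk] i.
  rewrite expr0 mul1mx expr0 mulr1 /W (bigD1 i) //= -addrA lerDl.
  by rewrite addr_ge0 ?sumr_ge0.
rewrite step !mxE normrM normfV mulrC ler_pdivrMr //.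
apply: le_trans (ler_normB _ _) _.
apply: (@le_trans _ _ ((W + D) * r ^+ k + K' * r ^+ k.+1)).
  by have := lerD (IHk i) (HK' k.+1 i); rewrite !mxE.
rewrite exprS mulrA DE -mulrA -subr_ge0.
have -> : (W + D) * (r * r ^+ k) * `|a| - ((W + D) * r ^+ k + D * ((`|a| * r - 1) * r ^+ k))
   = W * (`|a| * r - 1) * r ^+ k by ring.
by rewrite !mulr_ge0 ?exprn_ge0 // ltW.
Qed.

Variable R : realType.
Local Notation C := (complex R).

Lemma expanding_ratio (s : seq C) : all (fun a => 1 < `|a|) s ->
  exists2 r : R, 0 < r < 1 & all (fun a => 1 < `|a| * r%:C%C) s.
Proof.
elim: s => [_|a s IH /= /andP[a1 /IH [r /andP[r0 r1] Hr]]].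
  by exists (1 / 2) => //; lra.
pose m := complex.Re `|a|.
have am : `|a| = m%:C%C by rewrite RRe_real // normr_real.
have m1 : 1 < m by rewrite -(ltcR 1) -am.
pose t := (1 + m^-1) / 2.
have mV0 : 0 < m^-1 by rewrite invr_gt0; lra.
have mV1 : m^-1 < 1 by rewrite invf_lt1; lra.
exists (Num.max r t).
  by rewrite lt_max r0 /= gt_max r1 /= /t; lra.
apply/andP; split.
  rewrite am -rmorphM /= ltcR.
  apply: (@lt_le_trans _ _ (m * t)); last first.
    by rewrite ler_pM2l ?le_max ?lexx ?orbT //; lra.
  by rewrite /t mulrA mulrDr divff ?gt_eqF //; lra.
apply/allP => b bs; apply: (lt_le_trans (allP Hr _ bs)).
by rewrite ler_wpM2l // lecR le_max lexx.
Qed.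

Definition inv_matrix n (M : 'M[int]_n) : 'M[R]_n := invmx (map_mx intr M).

Lemma expanding_unitmx n (M : 'M[int]_n) : expanding_poly R (char_poly M) ->
  (map_mx intr M : 'M[R]_n) \in unitmx.
Proof.
move=> [_ + _]; rewrite char_poly_det normrM normr_sign mul1r => dM.
rewrite unitmxE unitfE det_map_mx intr_eq0; apply/eqP => d0.
by move: dM; rewrite d0.
Qed.

Lemma inverse_powers_decay n (M : 'M[int]_n.+1) : expanding_poly R (char_poly M) ->
  exists2 r : R, 0 < r < 1 & forall v : 'cV[R]_n.+1, exists2 K : R, 0 <= K &
    forall k i, `|(inv_matrix M ^+ k *m v) i 0| <= K * r ^+ k.
Proof.
move=> ep; have uM := expanding_unitmx ep.
have [s [Es _ s1 _]] := expanding_poly_factor ep (size_char_poly M).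
have [r r01 Hr] := expanding_ratio s1; exists r => // v.
have /andP[r0 _] := r01.
pose A : 'M[C]_n.+1 := map_mx intr M.
pose toC := map_mx (real_complex R).
have AE : A = toC n.+1 n.+1 (map_mx intr M).
  by apply/matrixP => i j; rewrite !mxE rmorph_int.
have NA : toC n.+1 n.+1 (inv_matrix M) *m A = 1%:M.
  by rewrite AE -map_mxM mulVmx // map_mx1.
have r0C : 0 < r%:C%C by rewrite (ltcR 0).
have [|K K0 HK] := inverse_powers_decay_complex NA r0C Hr (w := toC n.+1 1%N v).
  rewrite -Es map_char_poly Cayley_Hamilton ?mul0mx //.
have KE : K = (complex.Re K)%:C%C by rewrite RRe_real // ger0_real.
exists (complex.Re K) => [|k i]; first by rewrite -(lecR 0) -KE.
have := HK k i; rewrite KE.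
have -> : (complex.Re K)%:C%C * r%:C%C ^+ k = (complex.Re K * r ^+ k)%:C%C.
  by rewrite rmorphM rmorphXn.
rewrite -(rmorphXn (map_mx (real_complex R))) -map_mxM mxE.
by rewrite normc_def /= expr0n addr0 sqrtr_sqr lecR.
Qed.
End Decay.

(** * Widths of attractors *)

Section Attractors.
Variable R : realType.

Lemma cvg_cVP n (u : nat -> 'cV[R]_n) (x : 'cV[R]_n) :
  (u @ \oo --> x) <-> (forall i, (fun m => u m i 0) @ \oo --> x i 0).
Proof.
split=> [ux i|H].
  exact: (continuous_cvg _ (@coord_continuous R n 1 i 0 x) ux).
apply/cvg_ballP => e e0.
have : \forall m \near \oo, forall i, ball (x i 0) e (u m i 0).
  apply: filter_forall => i; have /cvg_ballP := H i; exact.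
by apply: filterS => m Hm; split=> // i j; rewrite (ord1 j).
Qed.

Definition pairing n (xi : 'rV[R]_n) (v : 'cV[R]_n) : R := (xi *m v) 0 0.

Lemma pairingE n (xi : 'rV[R]_n) v : pairing xi v = \sum_i xi 0 i * v i 0.
Proof. by rewrite /pairing mxE. Qed.

Lemma cvg_pairing n (xi : 'rV[R]_n) (u : nat -> 'cV[R]_n) x :
  u @ \oo --> x -> (fun m => pairing xi (u m)) @ \oo --> pairing xi x.
Proof.
move=> /cvg_cVP ux; rewrite pairingE.
have -> : (fun m => pairing xi (u m)) = (fun m => \sum_i xi 0 i * u m i 0).
  by apply/funext => m; rewrite pairingE.
apply: cvg_big => [|i _]; first exact: add_continuous.
by apply: cvgM; [exact: cvg_cst|exact: ux].
Qed.

Lemma cvg_mulmx n (L : 'M[R]_n) (u : nat -> 'cV[R]_n) x :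
  u @ \oo --> x -> (fun m => L *m u m) @ \oo --> L *m x.
Proof.
move=> ux; apply/cvg_cVP => i; have := cvg_pairing (xi := row i L) ux.
have E v : pairing (row i L) v = (L *m v) i 0.
  by rewrite /pairing -row_mul mxE.
by rewrite E (_ : (fun _ => _) = (fun m => (L *m u m) i 0)) //; apply/funext => m; rewrite E.
Qed.

Definition geometric_decay n (u : nat -> 'cV[R]_n) : Prop :=
  exists r K : R, [/\ 0 < r < 1, 0 <= K & forall k i, `|u k i 0| <= K * r ^+ k].

Lemma geometric_bound_cvg (a : nat -> R) (r K : R) : 0 < r < 1 -> 0 <= K ->
  (forall k, `|a k| <= K * r ^+ k) -> cvgn [normed series a].
Proof.
move=> /andP[r0 r1] K0 H.
apply: (@series_le_cvg _ _ (geometric K r)).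
- by move=> k; exact: normr_ge0.
- by move=> k; rewrite /geometric /= mulr_ge0 // exprn_ge0 // ltW.
- exact: H.
- by apply: is_cvg_geometric_series; rewrite gtr0_norm.
Qed.

Lemma geometric_decay_pairing n (u : nat -> 'cV[R]_n) xi : geometric_decay u ->
  cvgn [normed series (fun k => pairing xi (u k))].
Proof.
move=> [r [K [r01 K0 H]]].
apply: (@geometric_bound_cvg _ r (\sum_i `|xi 0 i| * K)) => //.
  by rewrite sumr_ge0 // => i _; rewrite mulr_ge0.
move=> k; rewrite pairingE (le_trans (ler_norm_sum _ _ _)) // mulr_suml.
by apply: ler_sum => i _; rewrite normrM -mulrA ler_wpM2l.
Qed.

Lemma geometric_decay_series n (u : nat -> 'cV[R]_n) : geometric_decay u ->
  exists x : 'cV[R]_n, (fun m => \sum_(0 <= k < m) u k) @ \oo --> x.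
Proof.
move=> [r [K [r01 K0 H]]].
exists (\col_i limn (series (fun k => u k i 0))); apply/cvg_cVP => i.
rewrite mxE (_ : (fun _ => _) = series (fun k => u k i 0)); last first.
  by apply/funext => m; rewrite /series /= summxE.
by apply: normed_cvg; apply: (geometric_bound_cvg r01 K0) => k; exact: H.
Qed.

Section Digits.
Variables (n : nat) (M : 'M[int]_n.+1) (d0 d1 : 'cV[int]_n.+1).
Hypothesis adm : admissible R M d0 d1.
Local Notation N := (inv_matrix R M).
Local Notation G := (attractor R M d0 d1).

(* Indexed from 0: [digit_vector v k] is the image of [v] under [M^-(k+1)]. *)
Definition digit_vector (v : 'cV[int]_n.+1) (k : nat) : 'cV[R]_n.+1 :=
  N ^+ k.+1 *m map_mx intr v.

(** Digits are read from index 1, as in [attractor], while the vectors are indexed from 0. *)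
Definition digit_sum (a : nat -> 'cV[int]_n.+1) m : 'cV[R]_n.+1 :=
  \sum_(0 <= k < m) digit_vector (a k.+1) k.

Lemma attractorP x : G x <-> exists a : nat -> 'cV[int]_n.+1,
  (forall k, a k = d0 \/ a k = d1) /\ digit_sum a @ \oo --> x.
Proof.
have E (a : nat -> 'cV[int]_n.+1) : (fun m => \sum_(1 <= k < m.+1)
    (invmx (map_mx intr M) ^+ k) *m map_mx intr (a k)) = digit_sum a.
  by apply/funext => m; rewrite big_add1.
by split=> -[a [Ha Hx]]; exists a; split=> //; move: Hx; rewrite E.
Qed.

Lemma digit_vector_decay v : geometric_decay (digit_vector v).
Proof.
have [ep _] := admissible_char_poly adm.
have [r r01 H] := inverse_powers_decay ep; have /andP[r0 r1] := r01.
have [K K0 HK] := H (map_mx intr v).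
exists r, K; split=> // k i; apply: le_trans (HK _ _) _.
by rewrite ler_wpM2l // ler_wiXn2l // ltW.
Qed.

Lemma digit_sum_cvg a : (forall k, a k = d0 \/ a k = d1) ->
  exists2 x, G x & digit_sum a @ \oo --> x.
Proof.
move=> Ha.
have [x Hx] : exists x : 'cV[R]_n.+1, digit_sum a @ \oo --> x.
  apply: (@geometric_decay_series _ (fun k => digit_vector (a k.+1) k)).
  have [ep _] := admissible_char_poly adm.
  have [r r01 H] := inverse_powers_decay ep; have /andP[r0 r1] := r01.
  have [K K0 HK] := H (map_mx intr d0); have [K' K'0 HK'] := H (map_mx intr d1).
  exists r, (K + K'); split=> //; first exact: addr_ge0.
  move=> k i; have rk : 0 <= r ^+ k by rewrite exprn_ge0 // ltW.
  have rk1 : r ^+ k.+1 <= r ^+ k by rewrite ler_wiXn2l // ltW.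
  have := HK k.+1 i; have := HK' k.+1 i; rewrite /digit_vector.
  by case: (Ha k.+1) => -> h1 h2; nra.
by exists x => //; apply/attractorP; exists a.
Qed.

Local Notation e := (d1 - d0).

Lemma digit_sumB a b m : (forall k, a k = d0 \/ a k = d1) ->
  (forall k, b k = d0 \/ b k = d1) ->
  digit_sum a m - digit_sum b m
  = \sum_(0 <= k < m) ((a k.+1 == d1)%:R - (b k.+1 == d1)%:R) *: digit_vector e k.
Proof.
move=> Ha Hb; rewrite /digit_sum -sumrB; apply: eq_bigr => k _.
have ne : (d0 == d1) = false.
  apply/negP => /eqP de; have [_ _] := adm; apply; exists 0.
  by rewrite de subrr mulmx0.
rewrite /digit_vector map_mxB.
by case: (Ha k.+1) => ->; case: (Hb k.+1) => ->;
  rewrite ?eqxx ?ne ?subrr ?scale0r ?subr0 ?sub0r ?scale1r ?scaleN1r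
    -?mulmxBr ?subrr ?mulmx0 ?mulmxBr ?opprB.
Qed.

(** Support function of the difference set [G - G], as [width_ge] and [width_attained] show. *)
Definition width (xi : 'rV[R]_n.+1) : R :=
  limn [normed series (fun k => pairing xi (digit_vector e k))].

Lemma pairing_sum (T : Type) (s : seq T) (c : T -> R) (F : T -> 'cV[R]_n.+1) xi :
  pairing xi (\sum_(k <- s) c k *: F k) = \sum_(k <- s) c k * pairing xi (F k).
Proof.
rewrite /pairing mulmx_sumr summxE; apply: eq_bigr => k _.
by rewrite -scalemxAr mxE.
Qed.

Lemma width_ge xi x y : G x -> G y -> pairing xi (x - y) <= width xi.
Proof.
move=> /attractorP [a [Ha ax]] /attractorP [b [Hb bx]].
have H := cvg_pairing (xi := xi) (cvgB (FF := eventually_filter) ax bx).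
have cN := geometric_decay_pairing (xi := xi) (digit_vector_decay e).
apply: (ler_cvg_to H cN); apply: nearW => m.
rewrite [X in pairing _ X](digit_sumB _ Ha Hb) pairing_sum.
apply: ler_sum => k _; set t := pairing _ _.
have := ler_norm t; have := ler_norm (- t); rewrite normrN => h1 h2.
by case: (_ == d1); case: (_ == d1) => /=; lra.
Qed.

(** Digits are chosen by the sign of the pairing, one point taking [d1] exactly where the other
    takes [d0]. *)
Lemma width_attained xi : exists x y, [/\ G x, G y & pairing xi (x - y) = width xi].
Proof.
pose s k := 0 <= pairing xi (digit_vector e k.-1).
pose a k := if s k then d1 else d0; pose b k := if s k then d0 else d1.
have Ha k : a k = d0 \/ a k = d1 by rewrite /a; case: ifP; [right|left].
have Hb k : b k = d0 \/ b k = d1 by rewrite /b; case: ifP; [left|right].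
have [x Gx ax] := digit_sum_cvg Ha; have [y Gy bx] := digit_sum_cvg Hb.
exists x, y; split=> //.
have H := cvg_pairing (xi := xi) (cvgB (FF := eventually_filter) ax bx).
have cN := geometric_decay_pairing (xi := xi) (digit_vector_decay e).
apply: (cvg_unique _ H) => //; apply: cvg_trans cN.
apply: near_eq_cvg; apply: nearW => m.
rewrite [X in pairing _ X](digit_sumB _ Ha Hb) pairing_sum.
apply: eq_bigr => k _; rewrite /a /b /s /=; set t := pairing _ _.
have ne : (d0 == d1) = false.
  apply/negP => /eqP de; have [_ _] := adm; apply; exists 0.
  by rewrite de subrr mulmx0.
case: (lerP 0 t) => t0; rewrite eqxx ne ?subr0 ?sub0r ?mul1r ?mulN1r.
  by rewrite ger0_norm.
by rewrite ltr0_norm.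
Qed.

End Digits.
End Attractors.

(** * Generators of a zonoid *)

Section ZonoidUniqueness.
Variables (R : realType) (n : nat).
Implicit Types (u v : nat -> 'cV[R]_n) (xi eta : 'rV[R]_n).

(** Support function of the zonoid that is the Minkowski sum of the segments from - u k to u k. *)
Definition zonoid_support u xi : R :=
  limn [normed series (fun k => pairing xi (u k))].

Lemma pairingD xi eta (v : 'cV[R]_n) : pairing (xi + eta) v = pairing xi v + pairing eta v.
Proof. by rewrite /pairing mulmxDl mxE. Qed.

Lemma pairingN xi (v : 'cV[R]_n) : pairing (- xi) v = - pairing xi v.
Proof. by rewrite /pairing mulNmx mxE. Qed.

Lemma pairingZ c xi (v : 'cV[R]_n) : pairing (c *: xi) v = c * pairing xi v.
Proof. by rewrite /pairing -scalemxAl mxE. Qed.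

Lemma pairingZr c xi (v : 'cV[R]_n) : pairing xi (c *: v) = c * pairing xi v.
Proof. by rewrite /pairing -scalemxAr mxE. Qed.

Lemma pairing0r xi : pairing xi 0 = 0.
Proof. by rewrite /pairing mulmx0 mxE. Qed.

(** Discarded generators become 0 instead of being removed, so the indices do not move. *)
Definition restrict_orthogonal (s : seq 'rV[R]_n) u k : 'cV[R]_n :=
  if all (fun xi => pairing xi (u k) == 0) s then u k else 0.

Lemma restrict_orthogonal_decay s u : geometric_decay u ->
  geometric_decay (restrict_orthogonal s u).
Proof.
move=> [r [K [r01 K0 H]]]; exists r, K; split=> // k i.
rewrite /restrict_orthogonal; case: ifP => _ //; rewrite mxE normr0.
by rewrite mulr_ge0 // exprn_ge0 //; case/andP: r01 => /ltW.
Qed.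

Lemma support_le u xi m : geometric_decay u ->
  \sum_(0 <= k < m) `|pairing xi (u k)| <= zonoid_support u xi.
Proof.
move=> gu; have cN := geometric_decay_pairing (xi := xi) gu.
apply: (nondecreasing_cvgn_le _ cN m).
by apply/nondecreasing_seqP => k; rewrite /= /series /= big_nat_recr //= lerDl.
Qed.

(* Since [|b + s a| + |b - s a| - 2 s |a| = 2 max (|b| - s |a|) 0], letting [s] grow
   keeps exactly the generators orthogonal to [xi]. *)
Definition corner u xi eta s : R :=
  zonoid_support u (eta + s *: xi) + zonoid_support u (eta - s *: xi)
  - 2 * s * zonoid_support u xi.

Lemma corner_cvg u xi eta s : geometric_decay u ->
  (fun m => \sum_(0 <= k < m)
     (`|pairing eta (u k) + s * pairing xi (u k)|
      + `|pairing eta (u k) - s * pairing xi (u k)|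
      - 2 * s * `|pairing xi (u k)|)) @ \oo --> corner u xi eta s.
Proof.
move=> gu.
have c1 := geometric_decay_pairing (xi := eta + s *: xi) gu.
have c2 := geometric_decay_pairing (xi := eta - s *: xi) gu.
have c3 := geometric_decay_pairing (xi := xi) gu.
have := cvgB (FF := eventually_filter) (cvgD (FF := eventually_filter) c1 c2)
  (cvgM (FF := eventually_filter) (@cvg_cst _ (2 * s) _ _ eventually_filter) c3).
rewrite -/(zonoid_support _ _) -/(zonoid_support _ _) -/(zonoid_support _ _) -/(corner u xi eta s).
apply: cvg_trans; apply: near_eq_cvg; apply: nearW => m /=.
rewrite -[LHS]/(\sum_(0 <= k < m) `|pairing (eta + s *: xi) (u k)|
  + \sum_(0 <= k < m) `|pairing (eta - s *: xi) (u k)|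
  - 2 * s * \sum_(0 <= k < m) `|pairing xi (u k)|).
rewrite mulr_sumr -big_split -sumrB; apply: eq_bigr => k _ /=.
by rewrite !pairingD pairingN !pairingZ.
Qed.

(** Generators orthogonal to [xi] contribute 2 |b|, and the others a nonnegative amount by the
    triangle inequality. *)
Lemma corner_ge u xi eta s : 0 <= s -> geometric_decay u ->
  2 * zonoid_support (restrict_orthogonal [:: xi] u) eta <= corner u xi eta s.
Proof.
move=> s0 gu; have H := corner_cvg (xi := xi) (eta := eta) (s := s) gu.
have c := geometric_decay_pairing (xi := eta) (restrict_orthogonal_decay [:: xi] gu).
have := cvgM (FF := eventually_filter) (@cvg_cst _ (2 : R) _ _ eventually_filter) c.
move=> {}c; apply: (ler_cvg_to c H); apply: nearW => m /=.
rewrite -[leLHS]/(2 * \sum_(0 <= k < m) `|pairing eta (restrict_orthogonal [:: xi] u k)|).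
rewrite mulr_sumr; apply: ler_sum => k _; rewrite /restrict_orthogonal /= andbT.
set a := pairing xi _; set b := pairing eta (u k).
case: eqP => [->|_]; rewrite ?pairing0r ?normr0 ?mulr0 ?addr0 ?subr0 -/b; first by lra.
have -> : 2 * s * `|a| = `|(b + s * a) - (b - s * a)|.
  by rewrite -(ger0_norm s0) -[2]gtr0_norm // -!normrM; congr `|_|; rewrite ger0_norm //; ring.
by have := ler_normB (b + s * a) (b - s * a); lra.
Qed.

(** Past some m the series for [eta] has a small tail. A large [s] cancels the contribution of the
    first m generators not orthogonal to [xi], and the later ones contribute at most twice the
    tail. *)
Lemma corner_le u xi eta eps : 0 < eps -> geometric_decay u ->
  exists2 s, 0 <= s &
    corner u xi eta s <= 2 * zonoid_support (restrict_orthogonal [:: xi] u) eta + eps.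
Proof.
move=> eps0 gu.
have cN := geometric_decay_pairing (xi := eta) gu.
have [m Hm] : exists m,
    zonoid_support u eta - eps / 2 <= \sum_(0 <= k < m) `|pairing eta (u k)|.
  have e2 : zonoid_support u eta - eps / 2 < zonoid_support u eta by lra.
  have := @cvgr_ge _ _ _ eventually_filter _ _ cN _ e2; case=> m _ /(_ m (leqnn m)) /= Hm; exists m.
  exact: Hm.
(* The sum of all the ratios dominates each one; where the denominator is 0 the quotient is 0. *)
pose s := \sum_(0 <= k < m) `|pairing eta (u k)| / `|pairing xi (u k)|.
have s0 : 0 <= s by rewrite sumr_ge0 // => k _; rewrite divr_ge0.
exists s => //.
have H := corner_cvg (xi := xi) (eta := eta) (s := s) gu.
apply: (cvgr_to_le H); exists m => // j mj /=.
have gr := restrict_orthogonal_decay [:: xi] gu.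
have S1 := support_le eta j gr; have S2 := support_le eta j gu.
rewrite (big_cat_nat (leq0n m) mj) /= in S2.
suff : \sum_(0 <= k < j)
     (`|pairing eta (u k) + s * pairing xi (u k)|
      + `|pairing eta (u k) - s * pairing xi (u k)|
      - 2 * s * `|pairing xi (u k)|) <=
   2 * \sum_(0 <= k < j) `|pairing eta (restrict_orthogonal [:: xi] u k)|
   + 2 * \sum_(m <= k < j) `|pairing eta (u k)|.
  by lra.
have up a b : `|b + s * a| + `|b - s * a| - 2 * s * `|a| <= 2 * `|b| :> R.
  have := ler_normD b (s * a); have := ler_normB b (s * a).
  by rewrite normrM (ger0_norm s0); lra.
rewrite 2!(big_cat_nat (leq0n m) mj) /= mulrDr -addrA lerD //.
  rewrite [leRHS]mulr_sumr big_nat_cond [leRHS]big_nat_cond.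
  apply: ler_sum => k /andP[/andP[_ km] _]; rewrite /restrict_orthogonal /= andbT.
  set a := pairing xi (u k); set b := pairing eta (u k).
  have [a0|a0] := eqVneq a 0.
    by rewrite -/b a0 mulr0 addr0 subr0 normr0 mulr0 subr0; lra.
  rewrite pairing0r normr0 mulr0.
  have : `|b| <= s * `|a|.
    rewrite -ler_pdivrMr ?normr_gt0 // /s (bigD1_seq k) ?iota_uniq //=; last first.
      by rewrite mem_index_iota km.
    by rewrite lerDl sumr_ge0 // => l _; rewrite divr_ge0.
  rewrite -[in 2 * s](ger0_norm s0) -{1}(ger0_norm s0) -mulrA -normrM.
  move: (s * a) (b) => t {}b.
  by case: (ger0P t); case: (ger0P b); case: (ger0P (b + t)); case: (ger0P (b - t)); lra.
rewrite -[leLHS]add0r lerD //; last by rewrite [leRHS]mulr_sumr; apply: ler_sum => k _; exact: up.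
by rewrite mulr_ge0 // sumr_ge0.
Qed.

(** [corner] depends only on the support function, and by the two bounds above its infimum over s >=
    0 is twice the restricted support function. *)
Lemma restrict_support_eq1 u v xi : geometric_decay u -> geometric_decay v ->
  zonoid_support u =1 zonoid_support v ->
  zonoid_support (restrict_orthogonal [:: xi] u)
    =1 zonoid_support (restrict_orthogonal [:: xi] v).
Proof.
suff le w w' eta : geometric_decay w -> geometric_decay w' ->
    zonoid_support w =1 zonoid_support w' ->
    zonoid_support (restrict_orthogonal [:: xi] w) eta
      <= zonoid_support (restrict_orthogonal [:: xi] w') eta.
  by move=> gu gv uv eta; apply/eqP; rewrite eq_le !le.
move=> gw gw' ww'; apply/ler_addgt0Pr => eps eps0.
have [s s0 Hs] := @corner_le w' xi eta (2 * eps) (mulr_gt0 (ltr0Sn _ _) eps0) gw'.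
have := corner_ge xi eta s0 gw.
by rewrite /corner !ww' -/(corner w' xi eta s); lra.
Qed.

Lemma restrict_support_eq u v s : geometric_decay u -> geometric_decay v ->
  zonoid_support u =1 zonoid_support v ->
  zonoid_support (restrict_orthogonal s u)
    =1 zonoid_support (restrict_orthogonal s v).
Proof.
move=> gu gv uv; elim: s => [|xi s IH].
  by move=> x; rewrite -[LHS]/(zonoid_support u x) uv.
have E w : restrict_orthogonal (xi :: s) w
    = restrict_orthogonal [:: xi] (restrict_orthogonal s w).
  apply/funext => k; rewrite /restrict_orthogonal /= andbT.
  by case: (all _ s); rewrite ?andbT ?andbF // pairing0r eqxx.
by rewrite !E; apply: restrict_support_eq1 => //; exact: restrict_orthogonal_decay.
Qed.

Lemma support_single u xi i : (forall k, k != i -> u k = 0) ->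
  zonoid_support u xi = `|pairing xi (u i)|.
Proof.
move=> u0; apply: (@cvg_lim _ (@Rhausdorff R)).
apply: cvg_near_cst; exists i.+1 => // m im /=; rewrite /series /=.
rewrite (bigD1_seq i) ?iota_uniq //= ?mem_index_iota //.
by rewrite big1 ?addr0 // => k ki; rewrite u0 // pairing0r normr0.
Qed.

(** The case c = 0 also excludes zero vectors. *)
Definition pairwise_nonparallel u : Prop :=
  forall k l c, u k = c *: u l -> k = l.

(** Restricting to the generators on the line of u i leaves only u i on one side and at most one v k
    on the other, and the support functions of these two segments agree. *)
Lemma zonoid_generators u v : geometric_decay u -> geometric_decay v ->
  pairwise_nonparallel u -> pairwise_nonparallel v ->
  zonoid_support u =1 zonoid_support v ->
  forall i, exists k, v k = u i \/ v k = - u i.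
Proof.
move=> gu gv nu nv uv i.
have nz w : pairwise_nonparallel w -> forall k, w k != 0.
  move=> nw k; apply/eqP => wk.
  by have := nw k k.+1 0; rewrite wk scale0r => /(_ erefl) /eqP; rewrite ltn_eqF.
(* The columns of the cokernel matrix are functionals whose common kernel is the line spanned by u
   i. *)
pose A := cokermx (u i)^T.
pose s := [seq (col j A)^T | j <- enum 'I_n].
have parallelP (z : 'cV[R]_n) : all (fun xi => pairing xi z == 0) s -> exists c, z = c *: u i.
  move=> /allP H.
  have : (z^T <= (u i)^T)%MS.
    rewrite submxE; apply/eqP/matrixP => a j; rewrite ord1 mxE [RHS]mxE.
    have /H/eqP : (col j A)^T \in s by apply: map_f; rewrite mem_enum.
    rewrite pairingE => e0; rewrite -[RHS]e0.
    by apply: eq_bigr => l _; rewrite !mxE mulrC.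
  by move/sub_rVP => [c /(congr1 trmx)]; rewrite linearZ /= !trmxK => ->; exists c.
have parallel_mem (c : R) : all (fun xi => pairing xi (c *: u i) == 0) s.
  apply/allP => _ /mapP [j _ ->]; rewrite pairingZr pairingE.
  have : ((u i)^T *m A) 0 j = 0 by rewrite mulmx_coker mxE.
  rewrite mxE => e0; rewrite [X in c * X](_ : _ = 0) ?mulr0 // -[RHS]e0.
  by apply: eq_bigr => l _; rewrite !mxE mulrC.
have E := restrict_support_eq s gu gv uv.
have Eu eta : zonoid_support (restrict_orthogonal s u) eta = `|pairing eta (u i)|.
  rewrite (@support_single _ _ i); last first.
    move=> k ki; rewrite /restrict_orthogonal; case: ifP => // /parallelP [c /nu].
    by move/eqP: ki.
  by rewrite /restrict_orthogonal -[u i]scale1r parallel_mem.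
have [[k vk]|nvk] := pselect (exists k, all (fun xi => pairing xi (v k) == 0) s); last first.
  have Z eta : pairing eta (u i) = 0.
    apply/eqP; rewrite -normr_eq0 -Eu E (@support_single _ _ 0%N).
      rewrite /restrict_orthogonal; case: ifP => [h|_]; last by rewrite pairing0r normr0.
      by case: nvk; exists 0%N.
    by move=> k _; rewrite /restrict_orthogonal; case: ifP => // h; case: nvk; exists k.
  have /eqP := nz _ nu i; case; apply/matrixP => a b; rewrite ord1 mxE -(Z (delta_mx 0 a)).
  by rewrite /pairing -rowE mxE.
exists k; have [c vc] := parallelP _ vk.
have c0 : c != 0 by apply: contra_neq (nz _ nv k) => c0; rewrite vc c0 scale0r.
have Ev eta : zonoid_support (restrict_orthogonal s v) eta = `|pairing eta (v k)|.
  rewrite (@support_single _ _ k); last first.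
    move=> l lk; rewrite /restrict_orthogonal; case: ifP => // /parallelP [c' vl].
    move/eqP: lk; case; apply: (nv _ _ (c' / c)).
    by rewrite vl vc scalerA divfK.
  by rewrite /restrict_orthogonal vk.
have [j uj] : exists j, u i j 0 != 0.
  apply/not_existsP => H; have /eqP := nz _ nu i; case; apply/matrixP => a b.
  by rewrite ord1 mxE; apply/eqP/negPn/negP/H.
have := E (delta_mx 0 j); rewrite Eu Ev vc pairingZr normrM.
have -> : pairing (delta_mx 0 j) (u i) = u i j 0 by rewrite /pairing -rowE mxE.
rewrite -[LHS]mul1r => /mulIf; rewrite normr_eq0 => /(_ uj) c1.
have /eqP := esym c1; rewrite eqr_norml ler01 andbT => /orP[] /eqP ->; [left|right].
  by rewrite scale1r.
by rewrite scaleN1r.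
Qed.
End ZonoidUniqueness.

(** * Affine similarity of attractors *)

Section Similarity.
Variables (R : realType) (n : nat).
Implicit Types M : 'M[int]_n.+1.

Lemma col_krylov (A : comNzRingType) (N : 'M[A]_n.+1) v (j : 'I_n.+1) :
  col j (krylov N v) = N ^+ j *m v.
Proof. by apply/matrixP => i k; rewrite !mxE ord1; apply: eq_bigr => l _. Qed.

Lemma col_mulmx (A : pzRingType) m p q (P : 'M[A]_(m, p)) (Q : 'M[A]_(p, q)) j :
  col j (P *m Q) = P *m col j Q.
Proof. by apply/matrixP => i k; rewrite !mxE; apply: eq_bigr => l _; rewrite !mxE. Qed.

Lemma matrix_col_eq (A : pzRingType) m (P Q : 'M[A]_(m, n.+1)) :
  (forall j, col j P = col j Q) -> P = Q.
Proof.
by move=> H; apply/matrixP => i j; have /matrixP/(_ i 0) := H j; rewrite !mxE.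
Qed.

(** [L] sends one Krylov basis to the other. On the last basis vector the intertwining holds because
    Cayley-Hamilton expresses the next power with the same coefficients. *)
Lemma conjugate_of_char_poly M M' (e e' : 'cV[int]_n.+1) :
  expanding_poly R (char_poly M) -> char_poly M = char_poly M' ->
  e != 0 -> e' != 0 ->
  exists L : 'M[R]_n.+1, [/\ L \in unitmx,
    L *m map_mx intr M = map_mx intr M' *m L
    & L *m map_mx intr e = map_mx intr e'].
Proof.
move=> ep pp e0 e'0; have ep' := ep; rewrite pp in ep'.
pose A : 'M[R]_n.+1 := map_mx intr M; pose A' : 'M[R]_n.+1 := map_mx intr M'.
pose v : 'cV[R]_n.+1 := map_mx intr e; pose v' : 'cV[R]_n.+1 := map_mx intr e'.
have uK := krylov_unit ep e0; have uK' := krylov_unit ep' e'0.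
rewrite -/A -/A' -/v -/v' in uK uK' *.
pose L := krylov A' v' *m invmx (krylov A v).
have LK : L *m krylov A v = krylov A' v' by rewrite mulmxKV.
have Lj j : (j < n.+1)%N -> L *m (A ^+ j *m v) = A' ^+ j *m v'.
  by move=> jn; rewrite -(col_krylov A v (Ordinal jn)) -col_mulmx LK col_krylov.
have top (B : 'M[R]_n.+1) (w : 'cV[R]_n.+1) : char_poly B = map_poly intr (char_poly M) ->
    B ^+ n.+1 *m w = - \sum_(i < n.+1) (map_poly intr (char_poly M))`_i *: (B ^+ i *m w).
  move=> cB; apply/eqP; rewrite -addr_eq0 addrC; apply/eqP.
  have := @horner_mx_mulVec _ _ B (char_poly B) w n.+2.
  rewrite size_char_poly Cayley_Hamilton mul0mx => /(_ (leqnn _)).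
  rewrite big_ord_recr /= -[X in (char_poly B)`_X]/(n.+2.-1) -{1}(size_char_poly B).
  by rewrite -lead_coefE (monicP (char_poly_monic B)) scale1r cB.
have cA : char_poly A = map_poly intr (char_poly M) by rewrite map_char_poly.
have cA' : char_poly A' = map_poly intr (char_poly M) by rewrite pp map_char_poly.
have Ltop : L *m (A ^+ n.+1 *m v) = A' ^+ n.+1 *m v'.
  rewrite !top // mulmxN mulmx_sumr; congr (- _); apply: eq_bigr => i _.
  by rewrite -scalemxAr Lj.
exists L; split.
- by rewrite unitmx_mul uK' unitmx_inv.
- have -> : L *m A = (L *m A *m krylov A v) *m invmx (krylov A v) by rewrite mulmxK.
  have -> : A' *m L = (A' *m L *m krylov A v) *m invmx (krylov A v) by rewrite mulmxK.
  congr (_ *m _); apply: matrix_col_eq => j; rewrite !col_mulmx !col_krylov.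
  have S1 : L *m A *m (A ^+ j *m v) = A' ^+ j.+1 *m v'.
    have -> : L *m A *m (A ^+ j *m v) = L *m (A ^+ j.+1 *m v).
      by rewrite exprS -[A * _]/(A *m _) !mulmxA.
    have [jn|] := ltnP j.+1 n.+1; first by rewrite Lj.
    by rewrite ltnS => nj; have -> : j = n :> nat by apply/eqP; rewrite eqn_leq nj -ltnS ltn_ord.
  have S2 : A' *m L *m (A ^+ j *m v) = A' ^+ j.+1 *m v'.
    by rewrite -mulmxA Lj // exprS -[A' * _]/(A' *m _) mulmxA.
  exact: (etrans S1 (esym S2)).
by have := Lj 0%N isT; rewrite !expr0 !mul1mx.
Qed.

Lemma conjugate_inverse_powers M M' (L : 'M[R]_n.+1) :
  expanding_poly R (char_poly M) -> expanding_poly R (char_poly M') ->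
  L *m map_mx intr M = map_mx intr M' *m L ->
  forall k, L *m inv_matrix R M ^+ k = inv_matrix R M' ^+ k *m L.
Proof.
move=> ep ep' LM.
have u := expanding_unitmx ep; have u' := expanding_unitmx ep'.
have L1 : L *m inv_matrix R M = inv_matrix R M' *m L.
  have := congr1 (fun X => inv_matrix R M' *m X *m inv_matrix R M) LM.
  by rewrite /inv_matrix !mulmxA mulVmx // mul1mx mulmxK.
elim=> [|k IH]; first by rewrite !expr0 mulmx1 mul1mx.
rewrite !exprS -[_ * _]/(_ *m _) -[X in _ = X *m L]/(_ *m _).
by rewrite mulmxA L1 -mulmxA IH mulmxA.
Qed.

Lemma admissible_digit_neq0 d (M : 'M[int]_d) d0 d1 : admissible R M d0 d1 -> d1 - d0 != 0.
Proof. by move=> [_ _ H]; apply/eqP => e0; apply: H; exists 0; rewrite e0 mulmx0. Qed.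

(** A linear map that conjugates M to M' and sends d1 - d0 to d1' - d0' matches the digit vectors of
    these differences; the translation aligns the two points with constant digits [d0] and [d0']. *)
Lemma affinely_similar_of_char_poly M d0 d1 M' d0' d1' :
  admissible R M d0 d1 -> admissible R M' d0' d1' ->
  char_poly M = char_poly M' ->
  affinely_similar (attractor R M d0 d1) (attractor R M' d0' d1').
Proof.
move=> adm adm' pp.
have [ep _] := admissible_char_poly adm; have [ep' _] := admissible_char_poly adm'.
have e0 := admissible_digit_neq0 adm; have e'0 := admissible_digit_neq0 adm'.
have [L [uL LM Le]] := conjugate_of_char_poly ep pp e0 e'0.
have LN := conjugate_inverse_powers ep ep' LM.
have [x0 Gx0 cx0] := digit_sum_cvg (a := fun=> d0) adm (fun=> or_introl erefl).
have [y0 Gy0 cy0] := digit_sum_cvg (a := fun=> d0') adm' (fun=> or_introl erefl).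
have ne : (d0 == d1) = false by rewrite eq_sym -subr_eq0 (negPf e0).
have ne' : (d0' == d1') = false by rewrite eq_sym -subr_eq0 (negPf e'0).
have transfer a a' x : (forall k, a k = d0 \/ a k = d1) -> (forall k, a' k = d0' \/ a' k = d1') ->
    (forall k, (a k == d1) = (a' k == d1')) -> digit_sum R M a @ \oo --> x ->
    digit_sum R M' a' @ \oo --> L *m x + (y0 - L *m x0).
  move=> Ha Ha' aa' ax.
  have c1 := cvg_mulmx (L := L) (cvgB (FF := eventually_filter) ax cx0).
  have := cvgD (FF := eventually_filter) c1 cy0.
  rewrite mulmxBr addrAC -addrA; apply: cvg_trans; apply: near_eq_cvg; apply: nearW => m.
  rewrite -[LHS]/(L *m (digit_sum R M a m - digit_sum R M (fun=> d0) m)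
    + digit_sum R M' (fun=> d0') m).
  apply/eqP; rewrite eq_sym -subr_eq; apply/eqP.
  rewrite (digit_sumB adm) //; last by left.
  rewrite (digit_sumB adm') //; last by left.
  rewrite mulmx_sumr; apply: eq_bigr => k _; rewrite -aa' ne ne' -scalemxAr; congr (_ *: _).
  rewrite /digit_vector mulmxA LN -mulmxA; congr (_ *m _).
  by rewrite !map_mxB in Le *.
exists L, (y0 - L *m x0); split=> //; apply/seteqP; split=> y.
  move=> /attractorP [a' [Ha' ay]].
  pose a k := if a' k == d1' then d1 else d0.
  have Ha k : a k = d0 \/ a k = d1 by rewrite /a; case: ifP; [right|left].
  have aa' k : (a k == d1) = (a' k == d1') by rewrite /a; case: ifP; rewrite ?eqxx ?ne.
  have [x Gx ax] := digit_sum_cvg adm Ha; exists x => //.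
  apply: (cvg_unique _ (transfer a a' x Ha Ha' aa' ax) ay).
  exact: norm_hausdorff.
move=> [x /attractorP [a [Ha ax]] <-].
pose a' k := if a k == d1 then d1' else d0'.
have Ha' k : a' k = d0' \/ a' k = d1' by rewrite /a'; case: ifP; [right|left].
apply/attractorP; exists a'; split=> //; apply: transfer ax => // k.
by rewrite /a'; case: ifP; rewrite ?eqxx ?ne'.
Qed.

(** The width of the second attractor in direction xi is that of the first in direction xi L, so the
    two families of generators have one support function, and [zonoid_generators] applies both
    ways. *)
Lemma affinely_similar_generators M d0 d1 M' d0' d1' :
  admissible R M d0 d1 -> admissible R M' d0' d1' ->
  affinely_similar (attractor R M d0 d1) (attractor R M' d0' d1') ->
  pairwise_nonparallel (digit_vector R M (d1 - d0)) ->
  pairwise_nonparallel (digit_vector R M' (d1' - d0')) ->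
  exists L : 'M[R]_n.+1, [/\ L \in unitmx,
    forall i, exists k (b : bool),
      L *m digit_vector R M (d1 - d0) i = (-1) ^+ b *: digit_vector R M' (d1' - d0') k
    & forall k, exists i (b : bool),
      L *m digit_vector R M (d1 - d0) i = (-1) ^+ b *: digit_vector R M' (d1' - d0') k].
Proof.
move=> adm adm' [L [b [uL HE]]] np np'; exists L.
have gu : geometric_decay (fun k => L *m digit_vector R M (d1 - d0) k).
  have [r [K [r01 K0 H]]] := digit_vector_decay adm (d1 - d0).
  exists r, (\sum_i \sum_j `|L i j| * K); split=> //.
    by rewrite sumr_ge0 // => i _; rewrite sumr_ge0 // => j _; rewrite mulr_ge0.
  have rk k : 0 <= r ^+ k by rewrite exprn_ge0 //; case/andP: r01 => /ltW.
  move=> k i; rewrite mxE (le_trans (ler_norm_sum _ _ _)) // [in leRHS](bigD1 i) //=.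
  rewrite mulrDl -[leLHS]addr0 lerD //.
    by rewrite mulr_suml; apply: ler_sum => j _; rewrite normrM -mulrA ler_wpM2l.
  by rewrite mulr_ge0 ?sumr_ge0 // => j _; rewrite sumr_ge0 // => l _; rewrite mulr_ge0.
have gv := digit_vector_decay adm' (d1' - d0').
have nu : pairwise_nonparallel (fun k => L *m digit_vector R M (d1 - d0) k).
  move=> k l c; rewrite scalemxAr => /(congr1 (mulmx (invmx L))); rewrite !mulmxA mulVmx // !mul1mx.
  exact: np.
have E xi : zonoid_support (fun k => L *m digit_vector R M (d1 - d0) k) xi
   = width M d0 d1 (xi *m L).
  rewrite /zonoid_support /width; congr (limn (series _)).
  by apply/funext => k /=; rewrite /pairing mulmxA.
have uv : zonoid_support (fun k => L *m digit_vector R M (d1 - d0) k)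
    =1 zonoid_support (digit_vector R M' (d1' - d0')).
  move=> xi; rewrite E -[RHS]/(width M' d0' d1' xi).
  have P x y : pairing xi ((L *m x + b) - (L *m y + b)) = pairing (xi *m L) (x - y).
    by rewrite opprD addrACA subrr addr0 -mulmxBr /pairing mulmxA.
  apply/eqP; rewrite eq_le; apply/andP; split.
    have [x [y [Gx Gy <-]]] := width_attained adm (xi *m L).
    by rewrite -P; apply: (width_ge adm'); rewrite HE; [exists x|exists y].
  have [x [y [Gx Gy <-]]] := width_attained adm' xi.
  move: Gx Gy; rewrite HE => -[x' Gx' <-] [y' Gy' <-]; rewrite P.
  exact: (width_ge adm).
split=> // i.
  have [k [H|H]] := zonoid_generators gu gv nu np' uv i; exists k.
    by exists false; rewrite scale1r H.
  by exists true; rewrite H scaleN1r opprK.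
have [k [H|H]] := zonoid_generators gv gu np' nu (fun xi => esym (uv xi)) i; exists k.
  by exists false; rewrite scale1r H.
by exists true; rewrite H scaleN1r.
Qed.
End Similarity.

(** * Comparing supports of characteristic polynomials *)

Section SupportComparison.
Variable d : nat.
Implicit Types p : {poly int}.

Definition near_binary p : Prop :=
  [/\ p \is monic, size p = d.+1, `|p`_0| = 2
    & forall j, (0 < j)%N -> `|p`_j| <= 1].

Definition support p : {set 'I_d.+1} := [set j : 'I_d.+1 | p`_j != 0].

(** The recurrence with coefficients of [p], once generator k is replaced by plus or minus generator
    sigma k of the other attractor and inverse powers are cleared by multiplying with the power t +
    1 of its matrix. *)
Definition shifted_relation p (sigma : nat -> nat) (b : nat -> bool) i t : {poly int} :=
  \sum_(j < d.+1) (p`_j * (-1) ^+ b (i - j)%N) *: 'X^(t - sigma (i - j)%N).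

Definition transports p p' (sigma : nat -> nat) (b : nat -> bool) : Prop :=
  injective sigma /\
  forall i t, (d <= i)%N ->
    (forall j : 'I_d.+1, j \in support p -> (sigma (i - j) <= t)%N) ->
    exists q, shifted_relation p sigma b i t = q * p'.

Variables (p p' : {poly int}) (sigma : nat -> nat) (b : nat -> bool).
Hypotheses (d0 : (0 < d)%N) (pb : near_binary p) (pb' : near_binary p')
  (tr : transports p p' sigma b).

Lemma ord0_support : ord0 \in support p.
Proof. by have [_ _ p0 _] := pb; rewrite inE -normr_gt0 p0. Qed.

Lemma coef_shifted_relation i t l (j : 'I_d.+1) : (d <= i)%N ->
  (forall j : 'I_d.+1, j \in support p -> (sigma (i - j) <= t)%N) ->
  j \in support p -> l = (t - sigma (i - j))%N ->
  (shifted_relation p sigma b i t)`_l = p`_j * (-1) ^+ b (i - j)%N.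
Proof.
have [inj _] := tr.
move=> di H js ->; rewrite coef_sum (bigD1 j) //= coefZ coefXn eqxx mulr1.
rewrite big1 ?addr0 // => k kj; rewrite coefZ coefXn.
have [->|ks] := eqVneq p`_k 0; first by rewrite mul0r mul0r.
have ks' : k \in support p by rewrite inE.
case: eqP => [e|]; last by rewrite mulr0.
have /inj : sigma (i - j)%N = sigma (i - k)%N.
  by have := H _ js; have := H _ ks'; lia.
move=> ijk; move/eqP: kj; case; apply/val_inj => /=.
by have := ltn_ord j; have := ltn_ord k; lia.
Qed.

Lemma coef_shifted_relation_neq0 i t l : (shifted_relation p sigma b i t)`_l != 0 ->
  exists2 j : 'I_d.+1, j \in support p & l = (t - sigma (i - j))%N.
Proof.
move=> H; apply/exists2P; apply/not_existsP => N; move/eqP: H; apply.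
rewrite coef_sum big1 // => j _; rewrite coefZ coefXn.
have [->|ks] := eqVneq p`_j 0; first by rewrite mul0r mul0r.
case: eqP => [e|]; last by rewrite mulr0.
by case: (N j); split; rewrite ?inE.
Qed.

(* The constant term of a multiple of [p'] is even, and the only even coefficient of
   [p] is its constant one. *)
Lemma sigma_max i (j : 'I_d.+1) : (d <= i)%N -> j \in support p ->
  (sigma (i - j) <= sigma i)%N.
Proof.
move=> di js; have [inj div] := tr.
have [jm jms Hm] := arg_maxnP (fun j : 'I_d.+1 => sigma (i - j)%N) ord0_support.
have [q hq] := div i (sigma (i - jm)%N) di Hm.
have := coef_shifted_relation di Hm jms (esym (subnn _)).
rewrite hq coef0M => e; have jm0 : jm = ord0.
  apply/val_inj/eqP; rewrite /= -leqn0 leqNgt; apply/negP => jmp.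
  have [_ _ _ /(_ _ jmp)] := pb; have [_ _ p'0 _] := pb'.
  have : p`_jm != 0 by have : jm \in support p := jms; rewrite inE.
  move: e p'0; move: (p`_jm) (q`_0) (p'`_0) => x y z.
  by rewrite -signr_odd oddb; case: (b _) => /=; rewrite ?expr1 ?expr0 ?mulr1 ?mulrN1; nia.
by move: (Hm j js); rewrite jm0 subn0.
Qed.

(** The constant coefficient of the relation at t = sigma i is ±p_0, so the quotient is nonzero. *)
Lemma sigma_quotient i : (d <= i)%N ->
  exists2 q, shifted_relation p sigma b i (sigma i) = q * p' & q != 0.
Proof.
move=> di; have Hm j (js : j \in support p) := sigma_max di js.
have [_ div] := tr; have [q hq] := div i (sigma i) di Hm; exists q => //.
have := coef_shifted_relation (l := 0%N) di Hm ord0_support.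
rewrite subn0 subnn => /(_ erefl); rewrite hq => e.
apply/eqP => q0; move: e; rewrite q0 mul0r coef0 => /esym/eqP.
have [_ _ p0 _] := pb; rewrite mulf_eq0 signr_eq0 orbF -normr_eq0 p0.
by [].
Qed.

(** A nonzero multiple of p' has degree at least d, and its leading exponent is some sigma i - sigma
    (i - j). *)
Lemma sigma_drop i : (d <= i)%N ->
  exists2 j : 'I_d.+1, j \in support p & (sigma (i - j) + d <= sigma i)%N.
Proof.
move=> di; have [q hq qn0] := sigma_quotient di.
have [pm' sp' _ _] := pb'.
set h := shifted_relation _ _ _ _ _ in hq.
have hn0 : h != 0 by rewrite hq mulf_neq0 // monic_neq0.
have : lead_coef h != 0 by rewrite lead_coef_eq0.
rewrite lead_coefE hq size_Mmonic // -hq => /coef_shifted_relation_neq0 [j js e].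
exists j => //; move: qn0 e; rewrite -size_poly_gt0 sp'.
by have := sigma_max di js; move: (size q) => s; lia.
Qed.

(** Each use of [sigma_drop] lowers [sigma] by at least d and the index by at most d, until the
    index is below d. *)
Lemma sigma_lower i : (i <= sigma i + d)%N.
Proof.
elim/ltn_ind: i => i IH; have [id|di] := ltnP i d.
  by rewrite (leq_trans (ltnW id)) // leq_addl.
have [j js Hj] := sigma_drop di.
have jd := ltn_ord j.
have j0 : (0 < j)%N by rewrite lt0n; apply/eqP => j0; move: Hj; rewrite j0 subn0; lia.
by have := IH (i - j)%N; lia.
Qed.

(* At an index where [sigma i - i] attains its lower limit, the relation has degree [d],
   so it is [± p'] itself. *)
Lemma support_injection : (forall i, (sigma i <= i + d)%N) ->
  exists2 g : 'I_d.+1 -> 'I_d.+1,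
    (forall j, j \in support p -> (g j <= j)%N) &
    {in support p &, injective g} /\ support p' = g @: support p.
Proof.
move=> up.
(* [c] is the lower limit of sigma k + d - k, which lies between 0 and 2 d and is attained
   infinitely often. *)
have [c [k0 low] often] : exists2 c : nat,
    (exists k0, forall k, (k0 <= k)%N -> (c + k <= sigma k + d)%N) &
    forall K, exists2 k, (K <= k)%N & (sigma k + d = c + k)%N.
  pose P c := `[< exists k0, forall k, (k0 <= k)%N -> (c + k <= sigma k + d)%N >].
  have P0 : exists c, P c by exists 0%N; apply/asboolP; exists 0%N => k _; exact: sigma_lower.
  have Pmax c : P c -> (c <= d.*2)%N.
    by move=> /asboolP [k0 /(_ k0 (leqnn _))]; have := up k0; lia.
  case: (ex_maxnP P0 Pmax) => c /asboolP [k0 low] cmax; exists c; first by exists k0.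
  move=> K; apply/exists2P/not_existsP => N.
  have : P c.+1.
    apply/asboolP; exists (maxn k0 K) => k; rewrite geq_max => /andP[k0k Kk].
    have := low _ k0k; rewrite leq_eqVlt => /orP[/eqP e|]; last by lia.
    by case: (N k).
  by move/cmax; rewrite ltnn.
have [k Kk kc] := often (k0 + d)%N.
have dk : (d <= k)%N by lia.
have gap (j : 'I_d.+1) : j \in support p -> (sigma k - sigma (k - j) <= j)%N.
  by move=> js; have := low (k - j)%N; have := ltn_ord j; lia.
have [q hq qn0] := sigma_quotient dk.
have Hm j (js : j \in support p) := sigma_max dk js.
have [pm' sp' _ _] := pb'.
set h := shifted_relation _ _ _ _ _ in hq.
have sh : (size h <= d.+1)%N.
  apply/leq_sizeP => l dl; apply/eqP/negPn/negP => /coef_shifted_relation_neq0 [j js e].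
  by have := gap j js; have := ltn_ord j; lia.
have qC : q = (q`_0)%:P.
  apply: size1_polyC; move: sh; rewrite hq size_Mmonic // sp'.
  by move: (size q) => s; lia.
have q00 : q`_0 != 0 by apply: contra_neq qn0 => e; rewrite qC e.
have hE l : (h`_l != 0) = (p'`_l != 0) by rewrite hq qC coefCM mulf_eq0 (negPf q00).
(* Capping at d makes [g] a map of ordinals; on the support the cap is inactive. *)
have gord (j : 'I_d.+1) : (minn d (sigma k - sigma (k - j)) < d.+1)%N by rewrite ltnS geq_minl.
pose g j := Ordinal (gord j).
have gE j : j \in support p -> g j = (sigma k - sigma (k - j))%N :> nat.
  by move=> js; rewrite /=; apply/minn_idPr; have := gap j js; have := ltn_ord j; lia.
exists g; first by move=> j js; rewrite gE // gap.
split.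
  move=> i j is_ js /(congr1 (@nat_of_ord _)); rewrite !gE //.
  have [inj _] := tr => e; have /inj : sigma (k - i)%N = sigma (k - j)%N.
    by have := Hm _ is_; have := Hm _ js; lia.
  by move=> e'; apply/val_inj => /=; have := ltn_ord i; have := ltn_ord j; lia.
apply/setP => l; rewrite inE -hE; apply/idP/imsetP.
  move=> /coef_shifted_relation_neq0 [j js e]; exists j => //.
  by apply/val_inj; rewrite -[RHS]/(nat_of_ord (g j)) gE.
move=> [j js ->]; rewrite gE // (coef_shifted_relation dk Hm js erefl).
by rewrite mulf_eq0 signr_eq0 orbF; move: js; rewrite inE.
Qed.

End SupportComparison.

(** Neither map raises an index, so the sums of the elements of the two supports bound each other,
    and their equality forces [g] to be the identity. *)
Lemma support_eq d (p p' : {poly int}) (g g' : 'I_d.+1 -> 'I_d.+1) :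
  (forall j, j \in support d p -> (g j <= j)%N) ->
  {in support d p &, injective g} -> support d p' = g @: support d p ->
  (forall j, j \in support d p' -> (g' j <= j)%N) ->
  {in support d p' &, injective g'} -> support d p = g' @: support d p' ->
  support d p = support d p'.
Proof.
move=> gl gi gs gl' gi' gs'.
have w1 : (\sum_(j in support d p') j = \sum_(j in support d p) g j)%N by rewrite gs big_imset.
have w2 : (\sum_(j in support d p) j = \sum_(j in support d p') g' j)%N by rewrite {1}gs' big_imset.
have w3 : (\sum_(j in support d p') g' j <= \sum_(j in support d p') j)%N by apply: leq_sum.
have w4 := leqif_sum (fun j js => leqif_eq (gl j js)).
have gid j : j \in support d p -> g j = j.
  case: w4 => w5 w6 js; apply/val_inj/eqP; move: j js; apply/forall_inP.
  by rewrite -w6 eqn_leq w5 -w1 w2 w3.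
rewrite gs; apply/setP => j; apply/idP/imsetP => [js|[k ks ->]]; last by rewrite gid.
by exists j; rewrite ?gid.
Qed.

(** * Similar attractors have characteristic polynomials of equal support *)

Section Separation.
Variables (R : realType) (n : nat).
Implicit Types M : 'M[int]_n.+1.

Lemma inv_matrix_powK M (i j : nat) (w : 'cV[R]_n.+1) :
  expanding_poly R (char_poly M) -> (j <= i)%N ->
  (map_mx intr M : 'M[R]_n.+1) ^+ j *m (inv_matrix R M ^+ i *m w)
    = inv_matrix R M ^+ (i - j) *m w.
Proof.
move=> ep ji; have uM := expanding_unitmx ep.
rewrite -{1}(subnKC ji) exprD -[_ * _]/(_ *m _) !mulmxA; congr (_ *m _).
rewrite -[RHS]mul1mx; congr (_ *m _).
elim: j {ji} => [|j IH]; first by rewrite !expr0 mulmx1.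
rewrite exprSr (exprS (inv_matrix R M)) -[_ * map_mx _ _]/(_ *m _) -[inv_matrix R M * _]/(_ *m _).
by rewrite mulmxA -(mulmxA (_ ^+ j)) mulmxV // mulmx1.
Qed.

Lemma matrix_powK M (i j : nat) (w : 'cV[R]_n.+1) :
  expanding_poly R (char_poly M) -> (i <= j)%N ->
  (map_mx intr M : 'M[R]_n.+1) ^+ j *m (inv_matrix R M ^+ i *m w)
    = (map_mx intr M : 'M[R]_n.+1) ^+ (j - i) *m w.
Proof.
move=> ep ij; rewrite -{1}(subnK ij) exprD -[_ * _]/(_ *m _) -mulmxA.
by rewrite inv_matrix_powK // subnn expr0 mul1mx.
Qed.

Lemma horner_mx_shifted_relation M (p : {poly int}) d sigma b i t (e : 'cV[int]_n.+1) :
  horner_mx M (shifted_relation d p sigma b i t) *m e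
  = \sum_(j < d.+1) (p`_j * (-1) ^+ b (i - j)%N) *: (M ^+ (t - sigma (i - j)%N) *m e).
Proof.
rewrite /shifted_relation linear_sum mulmx_suml; apply: eq_bigr => j _.
by rewrite linearZ /= rmorphXn /= horner_mx_X -scalemxAl.
Qed.

(** By Cayley-Hamilton the digit vectors satisfy the recurrence given by [char_poly M]; applying [L]
    and then M'^(t+1) clears the inverse powers, so the shifted relation kills d1' - d0'. *)
Lemma transports_of_generators M d0 d1 M' d0' d1' (L : 'M[R]_n.+1) :
  admissible R M d0 d1 -> admissible R M' d0' d1' ->
  L \in unitmx -> pairwise_nonparallel (digit_vector R M (d1 - d0)) ->
  (forall i, exists k (b : bool),
    L *m digit_vector R M (d1 - d0) i = (-1) ^+ b *: digit_vector R M' (d1' - d0') k) ->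
  exists (sigma : nat -> nat) (b : nat -> bool),
    (forall i, L *m digit_vector R M (d1 - d0) i
       = (-1) ^+ b i *: digit_vector R M' (d1' - d0') (sigma i)) /\
    transports n.+1 (char_poly M) (char_poly M') sigma b.
Proof.
move=> adm adm' uL np gen.
have [ep _] := admissible_char_poly adm; have [ep' _] := admissible_char_poly adm'.
have /choice [f Hf] : forall i, exists kb : nat * bool,
    L *m digit_vector R M (d1 - d0) i = (-1) ^+ kb.2 *: digit_vector R M' (d1' - d0') kb.1.
  by move=> i; have [k [b H]] := gen i; exists (k, b).
exists (fun i => (f i).1), (fun i => (f i).2); split=> //; split.
  move=> i k /= fik; apply: (np _ _ ((-1) ^+ (f i).2 * (-1) ^+ (f k).2)).
  apply: (can_inj (mulKmx uL)).
  by rewrite Hf fik -scalemxAr Hf scalerA -mulrA -signr_addb addbb expr0 mulr1.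
move=> i t ni Ht.
apply: (char_poly_annihilator ep' (admissible_digit_neq0 adm')).
have injR : injective (map_mx (intr : int -> R) : 'cV[int]_n.+1 -> _).
  move=> x y /matrixP xy; apply/matrixP => a c; have := xy a c; rewrite !mxE.
  exact: intr_inj.
apply: injR; rewrite map_mx0 horner_mx_shifted_relation.
pose A : 'M[R]_n.+1 := map_mx intr M; pose A' : 'M[R]_n.+1 := map_mx intr M'.
have rel : \sum_(j < n.+2) ((char_poly M)`_j)%:~R *: digit_vector R M (d1 - d0) (i - j) = 0.
  have := @horner_mx_mulVec _ _ A (char_poly A) (digit_vector R M (d1 - d0) i) n.+2.
  rewrite size_char_poly Cayley_Hamilton mul0mx => /(_ (leqnn _)) E; rewrite [RHS]E.
  apply: eq_bigr => j _; rewrite -map_char_poly coef_map /=; congr (_ *: _).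
  have ji : (j <= i.+1)%N by have := ltn_ord j; lia.
  rewrite /digit_vector inv_matrix_powK //; congr (_ ^+ _ *m _).
  by have := ltn_ord j; lia.
have := congr1 (fun w => A' ^+ t.+1 *m (L *m w)) rel.
rewrite !mulmx0 => <-; rewrite !mulmx_sumr raddf_sum; apply: eq_bigr => j _ /=.
have [pj|pj] := eqVneq (char_poly M)`_j 0.
  by rewrite pj mul0r !scale0r map_mx0 !mulmx0.
have js : j \in support n.+1 (char_poly M) by rewrite inE.
rewrite -!scalemxAr Hf -scalemxAr scalerA map_mxZ rmorphM rmorph_sign; congr (_ *: _).
rewrite /digit_vector matrix_powK // ?ltnS ?Ht // subSS.
by rewrite map_mxM -(rmorphXn (map_mx (intr : {rmorphism int -> R}))).
Qed.

(** The index maps of [L] and of its inverse are mutually inverse, so [sigma_lower] for one is the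
    upper bound that [support_injection] asks of the other. *)
Lemma support_eq_of_similar M d0 d1 M' d0' d1' :
  admissible R M d0 d1 -> admissible R M' d0' d1' ->
  near_binary n.+1 (char_poly M) -> near_binary n.+1 (char_poly M') ->
  pairwise_nonparallel (digit_vector R M (d1 - d0)) ->
  pairwise_nonparallel (digit_vector R M' (d1' - d0')) ->
  affinely_similar (attractor R M d0 d1) (attractor R M' d0' d1') ->
  support n.+1 (char_poly M) = support n.+1 (char_poly M').
Proof.
move=> adm adm' nb nb' np np' sim.
have [L [uL gen gen']] := affinely_similar_generators adm adm' sim np np'.
have [s [b [Hs tr]]] := transports_of_generators adm adm' uL np gen.
have sign2 (c : bool) (w : 'cV[R]_n.+1) : (-1) ^+ c *: ((-1) ^+ c *: w) = w.
  by rewrite scalerA -signr_addb addbb expr0 scale1r.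
have uV : invmx L \in unitmx by rewrite unitmx_inv.
have genV k : exists i (c : bool),
    invmx L *m digit_vector R M' (d1' - d0') k = (-1) ^+ c *: digit_vector R M (d1 - d0) i.
  have [i [c E]] := gen' k; exists i, c.
  by rewrite -[X in _ *m X](sign2 c) -E -scalemxAr mulKmx.
have [s' [b' [Hs' tr']]] := transports_of_generators adm' adm uV np' genV.
have ss' i : s' (s i) = i.
  apply: (np _ _ ((-1) ^+ b' (s i) * (-1) ^+ b i)).
  rewrite -scalerA -[X in _ = _ *: (_ *: X)](mulKmx uL) Hs -scalemxAr sign2 Hs'.
  by rewrite sign2.
have s's i : s (s' i) = i.
  apply: (np' _ _ ((-1) ^+ b (s' i) * (-1) ^+ b' i)).
  rewrite -scalerA -[X in _ = _ *: (_ *: X)](mulKVmx uL) Hs' -scalemxAr sign2 Hs.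
  by rewrite sign2.
have n0 : (0 < n.+1)%N by [].
have up i : (s i <= i + n.+1)%N by have := sigma_lower n0 nb' nb tr' (s i); rewrite ss'.
have up' i : (s' i <= i + n.+1)%N by have := sigma_lower n0 nb nb' tr (s' i); rewrite s's.
have [g gl [gi gs]] := support_injection n0 nb nb' tr up.
have [g' gl' [gi' gs']] := support_injection n0 nb' nb tr' up'.
exact: support_eq gl gi gs gl' gi' gs'.
Qed.
End Separation.

(** * Digit vectors that are pairwise nonparallel *)

(** Since - a (1 - (k/a) x) = k x - a, both sides are coefficients of the product of the X - a
    evaluated at k x. *)
Lemma coef_prod_rescale (F : fieldType) (k : F) (s : seq F) i : all (fun a => a != 0) s ->
  (\prod_(a <- s) (1 - (k / a)%:P * 'X))`_i * \prod_(a <- s) (- a)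
    = (\prod_(a <- s) ('X - a%:P))`_i * k ^+ i.
Proof.
elim: s i => [|b s IH] i /=.
  by move=> _; rewrite !big_nil !coef1 mulr1; case: i => [|i]; rewrite ?expr0 ?mul1r ?mul0r.
move=> /andP[b0 /IH {}IH]; rewrite !big_cons.
set Q := \prod_(j <- s) (1 - _) in IH *; set P := \prod_(j <- s) ('X - _) in IH *.
set z := \prod_(j <- s) - j in IH *.
rewrite !mulrBl mul1r !coefB -mulrA !coefCM !coefXM.
case: i => [|i] /=.
  by have := IH 0%N; rewrite expr0 mulr0 subr0 !mulr1 sub0r mulrCA => ->; rewrite mulNr.
have IH1 := IH i; have IH2 := IH i.+1.
have -> : (Q`_i.+1 - k / b * Q`_i) * (- b * z) = - b * (Q`_i.+1 * z) + k * (Q`_i * z).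
  by field.
by rewrite IH1 IH2 exprS; ring.
Qed.

Section Nonparallel.
Variables (R : realType) (n : nat).
Implicit Types M : 'M[int]_n.+1.
Local Notation C := (complex R).

(** M^m - c commutes with M, so if it kills a cyclic vector it kills the whole Krylov basis. *)
Lemma scalar_power M (e : 'cV[int]_n.+1) m (c : R) :
  expanding_poly R (char_poly M) -> e != 0 ->
  (map_mx intr M : 'M[R]_n.+1) ^+ m *m map_mx intr e = c *: map_mx intr e ->
  (map_mx intr M : 'M[R]_n.+1) ^+ m = c%:M.
Proof.
move=> ep e0 H; have uK := krylov_unit ep e0.
set A : 'M[R]_n.+1 := map_mx intr M in H uK *; set v := map_mx intr e in H uK.
have : A ^+ m *m krylov A v = c%:M *m krylov A v.
  apply: matrix_col_eq => j; rewrite !col_mulmx !col_krylov.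
  have -> : A ^+ m *m (A ^+ j *m v) = A ^+ j *m (A ^+ m *m v).
    by rewrite !mulmxA -[A ^+ m *m A ^+ j]/(A ^+ m * A ^+ j) -exprD addnC exprD.
  by rewrite H -scalemxAr mul_scalar_mx.
by move=> /(congr1 (mulmx^~ (invmx (krylov A v)))); rewrite !mulmxK.
Qed.

(* If two digit vectors are parallel, then a power of [M] is scalar and all roots of [p]
   have the same modulus [r], so [2 |p_(d-a)| = r^(2a) |p_a| < 2]. *)
Lemma nonparallel_of_coef M d0 d1 a :
  admissible R M d0 d1 -> near_binary n.+1 (char_poly M) ->
  (a.*2 < n.+1)%N -> (char_poly M)`_a != 0 -> (0 < a)%N ->
  pairwise_nonparallel (digit_vector R M (d1 - d0)).
Proof.
move=> adm [pm sp p0 p1] an pa a0.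
have [ep _] := admissible_char_poly adm; have e0 := admissible_digit_neq0 adm.
set p := char_poly M in pm sp p0 p1 pa ep.
set e := d1 - d0 in e0 *.
pose A : 'M[R]_n.+1 := map_mx intr M; pose v : 'cV[R]_n.+1 := map_mx intr e.
have v0 : v != 0.
  apply: contra_neq e0 => /matrixP ev; apply/matrixP => i j.
  by have /eqP := ev i j; rewrite !mxE intr_eq0 => /eqP.
suff key m c : (0 < m)%N -> A ^+ m *m v = c *: v -> False.
  move=> k l c H; case: (ltngtP k l) => // kl; exfalso.
  - have := congr1 (mulmx (A ^+ l.+1)) H.
    rewrite -scalemxAr /digit_vector !matrix_powK // ?subSS ?subnn ?expr0 ?mul1mx; last by lia.
    by move=> E; apply: (key (l - k)%N c); rewrite ?subn_gt0.
  - have := congr1 (mulmx (A ^+ k.+1)) H.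
    rewrite -scalemxAr /digit_vector !matrix_powK // ?subSS ?subnn ?expr0 ?mul1mx; last by lia.
    rewrite -/e -/v -/A => E; apply: (key (k - l)%N c^-1); rewrite ?subn_gt0 //.
    rewrite {2}E scalerA mulVf ?scale1r //; apply: contra_neq v0 => c0.
    by move: E; rewrite c0 scale0r.
move=> m0 H.
have Am : A ^+ m = c%:M := scalar_power ep e0 H.
have [s [Es ss s1 Er]] := expanding_poly_factor ep sp.
have pw z : z \in s -> z ^+ m = c%:C%C.
  move=> zs.
  have : eigenvalue (map_mx (real_complex R) A) z.
    rewrite eigenvalue_root_char -map_char_poly /A -map_char_poly -/p.
    have -> : map_poly (real_complex R) (map_poly intr p) = map_poly intr p.
      by apply/polyP => i; rewrite !coef_map /= rmorph_int.
    by rewrite Es root_prod_XsubC.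
  move=> /eigenvalueP [w wA w0].
  have wAk k : w *m (map_mx (real_complex R) A) ^+ k = z ^+ k *: w.
    elim: k => [|k IH]; first by rewrite !expr0 mulmx1 scale1r.
    by rewrite exprSr -[_ * _]/(_ *m _) mulmxA IH -scalemxAl wA scalerA exprSr.
  have := wAk m; rewrite -(rmorphXn (map_mx (real_complex R))) Am.
  rewrite /= map_scalar_mx mul_mx_scalar => /eqP; rewrite -subr_eq0 -scalerBl scaler_eq0.
  by rewrite (negPf w0) orbF subr_eq0 => /eqP.
have [z0 z0s] : exists z0, z0 \in s by case: (s) ss => // z0 s' _; exists z0; rewrite mem_head.
set r := `|z0|.
have rs z : z \in s -> `|z| = r.
  move=> zs; apply/eqP; rewrite /r -(@eqrXn2 _ m) // -!normrX.
  by rewrite (pw _ zs) (pw _ z0s).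
have r1 : 1 < r by exact: (allP s1).
have P0 : \prod_(z <- s) (- z) = (p`_0)%:~R.
  rewrite -[(p`_0)%:~R](coef_map (intr : {rmorphism int -> C})) /= Es -horner_coef0.
  by rewrite horner_prod; apply: eq_bigr => z _; rewrite !hornerE.
have prodr (t : seq C) : {in t, forall z, `|z| = r} -> \prod_(z <- t) `|z| = r ^+ size t.
  elim: t => [_|b t IH H']; first by rewrite big_nil.
  rewrite big_cons H' ?mem_head // IH ?exprS // => z zt.
  by apply: H'; rewrite in_cons zt orbT.
have rd : r ^+ n.+1 = 2.
  have := congr1 Num.norm P0; rewrite normr_prod -intr_norm p0 -ss -prodr // => E.
  rewrite -[RHS]E.
  by apply: eq_bigr => z _; rewrite normrN.
have s0 : all (fun z => z != 0) s.
  apply/allP => z /(allP s1) z1; rewrite -normr_gt0; exact: lt_trans z1.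
(* All roots have modulus r, so r^2 / z is the conjugate of z, and the rescaled product is the
   reverse of p. *)
have := coef_prod_rescale (r ^+ 2) a s0.
have -> : \prod_(z <- s) (1 - (r ^+ 2 / z)%:P * 'X) = \prod_(z <- s) (1 - (z^*)%:P * 'X).
  apply: eq_big_seq => z zs; congr (1 - _%:P * _).
  by rewrite -(rs z zs) normCK mulrAC divff ?mul1r // (allP s0).
rewrite P0 -Er -Es !coef_map /= coef_poly ltnS => /(congr1 Num.norm).
have -> : (a <= n.+1)%N by lia.
rewrite !normrM -!intr_norm p0 normrX normrX /r normr_id -/r -exprM => E.
have pa1 : `|p`_a| = 1.
  by move: (p1 a a0) pa; move: (p`_a) => x; lia.
have lt2 : r ^+ (2 * a) < 2.
  by rewrite -rd ltr_eXn2l // mul2n.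
rewrite pa1 mul1r in E.
move: lt2; rewrite -E; have -> : (2 : C) = 1%:~R * 2%:~R by rewrite mul1r.
rewrite -!intrM ltr_int => h.
have pz : p`_(n.+1 - a) = 0.
  by move: h; move: (p`_(n.+1 - a)) => x; lia.
have r0 : 0 < r ^+ (2 * a) by rewrite exprn_gt0 // (lt_trans _ r1).
by move: r0; rewrite -E pz normr0 mul0r ltxx.
Qed.
End Nonparallel.

(** * A two-parameter family of expanding polynomials *)

(** With m' the odd part of m, m divides m' k, so z^(k m') is 1, whereas it is also (-1)^m' = -1. *)
Lemma root_of_unity_parity (F : fieldType) (z : F) m k : (2%:R : F) != 0 ->
  (0 < m)%N -> (0 < k)%N -> (logn 2 m <= logn 2 k)%N ->
  z ^+ m = 1 -> z ^+ k = -1 -> False.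
Proof.
move=> two m0 k0 mk zm zk.
have [m' co mE] := pfactor_coprime (isT : prime 2) m0.
have /dvdnP [l E] : (m %| m' * k)%N.
  by rewrite {1}mE dvdn_mul // pfactor_dvdn.
have : z ^+ (k * m') = 1 by rewrite mulnC E mulnC exprM zm expr1n.
have od : odd m' by rewrite -coprime2n.
rewrite exprM zk -signr_odd od expr1 => /eqP; rewrite eq_sym -subr_eq0 opprK.
by rewrite -mulr2n (negPf two).
Qed.

(** Inversion maps the disc |1 - A| <= 1, punctured at 0, onto the half-plane of real part at least
    1/2. *)
Lemma inverse_disc_real_part (F : numClosedFieldType) (A : F) : A != 0 ->
  `|1 - A| <= 1 -> 2^-1 <= 'Re A^-1.
Proof.
move=> A0 H.
have a0 : 0 < `|A| ^+ 2 by rewrite exprn_gt0 // normr_gt0.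
have h : `|1 - A| ^+ 2 <= 1 by rewrite expr_le1.
have : 0 <= A + A^* - `|A| ^+ 2.
  rewrite (_ : _ - _ = 1 - `|1 - A| ^+ 2) ?subr_ge0 //.
  by rewrite !normCK rmorphB rmorph1; ring.
rewrite subr_ge0 normCK => {}h.
have E : 'Re A^-1 = (A + A^*) / (2 * (A * A^*)).
  by rewrite ReE fmorphV; field; rewrite conjC_eq0 A0.
have AA : 0 < A * A^* by rewrite -normCK.
rewrite E ler_pdivlMr; last by rewrite mulr_gt0.
by rewrite mulKf ?pnatr_eq0.
Qed.

(* The expression is [A + B - T A B] with [A = 1 - Z] and [B = 1 - W], so a zero with
   [A B <> 0] satisfies [T = A^-1 + B^-1], where both inverses have real part >= 1/2. *)
Lemma disc_zeros (F : numClosedFieldType) (Z W T : F) :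
  `|Z| <= 1 -> `|W| <= 1 -> `|T| <= 1 ->
  2 - Z - W - T + Z * T + W * T - Z * W * T = 0 ->
  (Z = 1 /\ W = 1) \/ (T = 1 /\ Z * W = 1).
Proof.
move=> Z1 W1 T1 H.
have H' : (1 - Z) + (1 - W) - T * ((1 - Z) * (1 - W)) = 0 by rewrite -[RHS]H; ring.
have [A0|A0] := eqVneq (1 - Z) 0.
  left; have B0 : 1 - W = 0 by rewrite -[RHS]H' A0; ring.
  by split; apply/eqP; rewrite eq_sym -subr_eq0; apply/eqP.
have [B0|B0] := eqVneq (1 - W) 0.
  by case/eqP: A0; rewrite -[RHS]H' B0; ring.
have TE : T = (1 - Z)^-1 + (1 - W)^-1.
  apply: (mulIf (mulf_neq0 A0 B0)).
  have -> : ((1 - Z)^-1 + (1 - W)^-1) * ((1 - Z) * (1 - W)) = (1 - Z) + (1 - W).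
    by field; rewrite A0 B0.
  by apply/eqP; rewrite eq_sym -subr_eq0; apply/eqP.
have RA : 2^-1 <= 'Re (1 - Z)^-1 by apply: inverse_disc_real_part; rewrite // opprB addrC subrK.
have RB : 2^-1 <= 'Re (1 - W)^-1 by apply: inverse_disc_real_part; rewrite // opprB addrC subrK.
have RT : 1 <= 'Re T.
  rewrite TE raddfD /= (le_trans _ (lerD RA RB)) //.
  by rewrite -mulr2n -[_ *+ 2]mulr_natl divff ?pnatr_eq0.
right; have T1' : T = 1.
  have [le1 eq1] := leif_Re_Creal T.
  have ReT : 'Re T = `|T| by apply/eqP; rewrite eq_le le1 (le_trans T1 RT).
  have T0 : 0 <= T by rewrite -eq1 ReT.
  by apply/eqP; rewrite eq_le -{1}(ger0_norm T0) T1 -(ger0_norm T0) -ReT.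
split=> //; move: H'; rewrite T1' mul1r => H'.
by rewrite -[RHS]subr0 -[X in 1 - X]H'; ring.
Qed.

Section Family.
Variables a b c : nat.
Hypotheses (a0 : (0 < a)%N) (ab : (a < b)%N) (bc : (b < c)%N).
Let d := (a + b + c)%N.

Definition family_exponents : seq nat := [:: 0; a; b; c; a + c; b + c; a + b + c]%N.

(** The expansion of (1 - Z) + (1 - W) - T (1 - Z) (1 - W) for signed powers Z, W, T of x; the
    scalar in front makes it monic. *)
Definition family_poly (s t u : bool) : {poly int} :=
  - (-1) ^+ s * (-1) ^+ t * (-1) ^+ u *:
  (2%:P - (-1) ^+ s *: 'X^a - (-1) ^+ t *: 'X^b - (-1) ^+ u *: 'X^c
   + ((-1) ^+ s * (-1) ^+ u) *: 'X^(a + c) + ((-1) ^+ t * (-1) ^+ u) *: 'X^(b + c)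
   - ((-1) ^+ s * (-1) ^+ t * (-1) ^+ u) *: 'X^(a + b + c)).

Lemma coef_family s t u j : (family_poly s t u)`_j =
  - (-1) ^+ s * (-1) ^+ t * (-1) ^+ u *
  (2 * (j == 0%N)%:R - (-1) ^+ s * (j == a)%:R - (-1) ^+ t * (j == b)%:R - (-1) ^+ u * (j == c)%:R
   + (-1) ^+ s * (-1) ^+ u * (j == a + c)%N%:R + (-1) ^+ t * (-1) ^+ u * (j == b + c)%N%:R
   - (-1) ^+ s * (-1) ^+ t * (-1) ^+ u * (j == a + b + c)%N%:R).
Proof.
rewrite /family_poly !(coefZ, coefD, coefN, coefB, coefXn, coefC).
by congr (_ * (_ - _ - _ - _ + _ + _ - _)); case: eqP; rewrite ?mulr1 ?mulr0.
Qed.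

Lemma coef_family_val s t u j :
  let v := (family_poly s t u)`_j in
  [/\ (v != 0) = (j \in family_exponents), (j != 0%N -> `|v| <= 1),
     j == 0%N -> `|v| = 2 & j == (a + b + c)%N -> v = 1].
Proof.
rewrite /= coef_family /family_exponents !inE.
(* The seven exponents are distinct, so at most one of the tests succeeds. *)
have one : ((j == 0)%N + (j == a) + (j == b) + (j == c) + (j == a + c) + (j == b + c)
    + (j == a + b + c) <= 1)%N by lia.
move: one; move: (j == 0)%N (j == a) (j == b) (j == c) (j == (a + c)%N) (j == (b + c)%N)
  (j == (a + b + c)%N) => [] [] // [] // [] // [] // [] // [] // _;
by case: s; case: t; case: u.
Qed.

Lemma family_near_binary s t u : near_binary d (family_poly s t u).
Proof.
have c0 j : (d < j)%N -> (family_poly s t u)`_j = 0.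
  move=> dj; have [v0 _ _ _] := coef_family_val s t u j.
  apply/eqP/negPn; rewrite v0 /family_exponents !inE; move: dj; rewrite /d; lia.
have cd : (family_poly s t u)`_d = 1.
  by have [_ _ _ H] := coef_family_val s t u d; exact: H.
have sz : size (family_poly s t u) = d.+1.
  apply/eqP; rewrite eqn_leq; apply/andP; split; first by apply/leq_sizeP.
  by rewrite ltnNge; apply/negP => /leq_sizeP/(_ d (leqnn _)); rewrite cd.
split=> //.
- by rewrite monicE lead_coefE sz cd.
- by have [_ _ H _] := coef_family_val s t u 0; exact: H.
- by move=> j j0; have [_ H _ _] := coef_family_val s t u j; apply: H; rewrite -lt0n.
Qed.

Lemma family_support s t u (j : 'I_d.+1) :
  (j \in support d (family_poly s t u)) = (val j \in family_exponents).
Proof. by rewrite inE; have [-> _ _ _] := coef_family_val s t u j. Qed.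

(** A root in the closed disc falls under [disc_zeros]. Z and W get opposite signs, the minus sign
    going to the exponent of larger 2-adic valuation, which excludes Z = W = 1. The other
    alternative gives z^(a+b) = -1, and the sign of T, set by comparing the valuations of a + b and
    c, excludes it. *)
Lemma family_expanding (R : realType) :
  exists s t u, expanding_poly R (family_poly s t u).
Proof.
have sgn (F : fieldType) (s : bool) (z : F) : (-1) ^+ s * z = 1 -> z = (-1) ^+ s.
  by move=> /(congr1 (fun x => (-1) ^+ s * x)); rewrite signrMK mulr1.
have two : (2%:R : complex R) != 0 by rewrite pnatr_eq0.
pose s := (logn 2 b <= logn 2 a)%N; pose u := (logn 2 (a + b) < logn 2 c)%N.
exists s, (~~ s), u; have [pm _ p0 _] := family_near_binary s (~~ s) u.
split=> // z rz.
rewrite real_ltNge ?real1 ?normr_real //; apply/negP => z1.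
pose Z := (-1) ^+ s * z ^+ a; pose W := (-1) ^+ (~~ s) * z ^+ b; pose T := (-1) ^+ u * z ^+ c.
have n1 (e : bool) k : `|(-1) ^+ e * z ^+ k| <= 1.
  by rewrite normrM normr_sign mul1r normrX exprn_ile1.
have := @disc_zeros _ Z W T (n1 _ _) (n1 _ _) (n1 _ _).
have E : 2 - Z - W - T + Z * T + W * T - Z * W * T = 0.
  move: rz; rewrite /family_poly map_polyZ rootZ; last first.
    by rewrite intr_eq0 !mulf_neq0 ?oppr_eq0 ?signr_eq0.
  rewrite rootE !(rmorphD, rmorphB, rmorphN) /= !map_polyZ !map_polyXn map_polyC /=.
  rewrite !(hornerD, hornerN, hornerZ, hornerXn, hornerC) => /eqP <-.
  rewrite !(rmorphM, rmorph_sign) /= /Z /W /T !exprD; ring.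
move=> /(_ E) [[/sgn za /sgn zb]|[/sgn zc ZW]].
  move: za zb; rewrite /s; case: leqP => /= h; rewrite ?expr1 ?expr0 => za zb.
    by apply: (root_of_unity_parity two _ a0 h zb za); lia.
  by apply: (root_of_unity_parity two a0 _ (ltnW h) za zb); lia.
have zab : z ^+ (a + b) = -1.
  have : (-1) ^+ true * z ^+ (a + b) = 1.
    rewrite -[RHS]ZW /Z /W exprD; case: (s) => /=; rewrite ?expr0 ?expr1; ring.
  by move/sgn.
move: zc; rewrite /u; case: ltnP => h; rewrite ?expr0 ?expr1 => zc.
  have z2 : z ^+ (2 * (a + b)) = 1 by rewrite mulnC exprM zab sqrrN expr1n.
  apply: (root_of_unity_parity two _ _ _ z2 zc); [lia|lia|].
  by rewrite lognM ?addn_gt0 ?a0.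
by apply: (root_of_unity_parity two _ _ h zc zab); lia.
Qed.
End Family.

(** [a] is the least positive exponent and [b] the next one. *)
Lemma family_exponents_inj a b c a' b' c' :
  (0 < a)%N -> (a < b)%N -> (b < c)%N -> (0 < a')%N -> (a' < b')%N -> (b' < c')%N ->
  (forall x, (x <= maxn b b')%N ->
     (x \in family_exponents a b c) = (x \in family_exponents a' b' c')) ->
  a = a' /\ b = b'.
Proof.
have low x y z w : (x < y)%N -> (y < z)%N -> w \in family_exponents x y z ->
    (0 < w)%N -> (x <= w)%N /\ ((x < w)%N -> (y <= w)%N).
  rewrite /family_exponents !inE => xy yz.
  by case/or4P => [/eqP ->|/eqP ->|/eqP ->|/or4P[/eqP ->|/eqP ->|/eqP ->|/eqP ->]]; lia.
have mem x y z : (x \in family_exponents x y z) /\ (y \in family_exponents x y z).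
  by rewrite /family_exponents !inE !eqxx !orbT.
move=> a0 ab bc a0' ab' bc' H.
have [ma mb] := mem a b c; have [ma' mb'] := mem a' b' c'.
rewrite H in ma; last by rewrite leq_max (ltnW ab).
rewrite H in mb; last by rewrite leq_maxl.
rewrite -H in ma'; last by rewrite leq_max (ltnW ab') orbT.
rewrite -H in mb'; last by rewrite leq_maxr.
have b0 := ltn_trans a0 ab; have b0' := ltn_trans a0' ab'.
have [la _] := low _ _ _ _ ab' bc' ma a0; have [la' _] := low _ _ _ _ ab bc ma' a0'.
have aa : a = a' by apply/eqP; rewrite eqn_leq la' la.
split=> //; have [_ lb] := low _ _ _ _ ab' bc' mb b0; have [_ lb'] := low _ _ _ _ ab bc mb' b0'.
by apply/eqP; rewrite eqn_leq lb' ?lb // ?aa // -aa.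
Qed.

(** * Counting similarity classes *)

Section Classes.
Variables (R : realType) (n : nat).
Local Notation d := n.+1.

Lemma affinely_similar_refl (G : set 'cV[R]_d) : affinely_similar G G.
Proof.
exists 1%:M, 0; split; first exact: unitmx1.
apply/seteqP; split=> [x Gx|_ [x Gx <-]]; last by rewrite mul1mx addr0.
by exists x => //; rewrite mul1mx addr0.
Qed.

Lemma affinely_similar_sym (G H : set 'cV[R]_d) : affinely_similar G H -> affinely_similar H G.
Proof.
move=> [L [b [uL ->]]]; exists (invmx L), (- (invmx L *m b)).
split; first by rewrite unitmx_inv.
have E x : invmx L *m (L *m x + b) - invmx L *m b = x by rewrite mulmxDr addrK mulKmx.
apply/seteqP; split=> [x Gx|_ [_ [x Gx <-] <-]]; last by rewrite E.
by exists (L *m x + b); [exists x|exact: E].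
Qed.

Lemma affinely_similar_trans (G H K : set 'cV[R]_d) :
  affinely_similar G H -> affinely_similar H K -> affinely_similar G K.
Proof.
move=> [L [b [uL ->]]] [L' [b' [uL' ->]]]; exists (L' *m L), (L' *m b + b').
split; first by rewrite unitmx_mul uL' uL.
have E x : L' *m (L *m x + b) + b' = L' *m L *m x + (L' *m b + b').
  by rewrite mulmxDr mulmxA addrA.
apply/seteqP; split=> [_ [_ [x Gx <-] <-]|_ [x Gx <-]]; first by exists x.
by exists (L *m x + b); [exists x|exact: E].
Qed.

Definition similarity_class (G : set 'cV[R]_d) : set (set 'cV[R]_d) :=
  [set H | two_attractors R d H /\ affinely_similar G H].

Lemma similarity_class_eq (G H : set 'cV[R]_d) : two_attractors R d H ->
  similarity_class G = similarity_class H <-> affinely_similar G H.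
Proof.
move=> aH; split=> [E|GH].
  have : similarity_class H H by split=> //; exact: affinely_similar_refl.
  by rewrite -E => -[].
apply/seteqP; split=> K [aK sK]; split=> //.
  exact: affinely_similar_trans (affinely_similar_sym GH) sK.
exact: affinely_similar_trans GH sK.
Qed.

(** A class is sent to the signature of the characteristic polynomial of a representative; the
    signature determines the polynomial, and the polynomial the class. *)
Lemma attractor_classes_finite_card :
  finite_set (attractor_classes R d) /\
  (num_attractors R d <=
     #|[set f : bool * {ffun 'I_n -> 'I_7} | (\sum_i f.2 i ^ 2 <= 48)%N]%SET|)%N.
Proof.
have [sig [sinj ssum]] := @expanding_poly_signature R d isT.
have /choice [phi Hphi] : forall X, exists y : bool * {ffun 'I_n -> 'I_7},
    attractor_classes R d X -> exists M d0 d1, [/\ admissible R M d0 d1,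
      X = similarity_class (attractor R M d0 d1) & y = sig (char_poly M)].
  move=> X; have [[G [M [d0 [d1 [adm GE]]]] XE]|nX] := pselect (attractor_classes R d X).
    by exists (sig (char_poly M)) => _; exists M, d0, d1; rewrite -XE GE.
  by exists (true, [ffun=> ord0]) => /nX.
have inj : {in attractor_classes R d &, injective phi}.
  move=> X Y /set_mem /Hphi [M [d0 [d1 [adm -> ->]]]] /set_mem /Hphi [M' [d0' [d1' [adm' -> ->]]]].
  move/(sinj _ _ (admissible_char_poly adm) (admissible_char_poly adm')) => pp.
  apply/similarity_class_eq; first by exists M', d0', d1'.
  exact: affinely_similar_of_char_poly.
have fin : finite_set (attractor_classes R d).
  have := inj_card_eq inj; move=> /eq_finite_set <-; exact: finite_finset.
split=> //; rewrite /num_attractors.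
set F := fset_set _.
have FE X : (X \in F) = (X \in attractor_classes R d) by rewrite in_fset_set.
have uniqF : uniq (map phi F).
  rewrite map_inj_in_uniq ?fset_uniq // => X Y; rewrite !FE; exact: inj.
rewrite -[#|` F|](size_map phi) -(card_uniqP uniqF).
apply: subset_leq_card; apply/fintype.subsetP => x /mapP [X XF ->].
rewrite FE in XF; have [M [d0 [d1 [adm _ ->]]]] := Hphi X (set_mem XF).
by rewrite inE; exact: ssum (admissible_char_poly adm).
Qed.

Lemma num_attractors_small : (num_attractors R d <= 2 * 7 ^ n)%N.
Proof.
have [_ H] := attractor_classes_finite_card.
by rewrite -card_signatures_le (leq_trans H) // max_card.
Qed.

Lemma num_attractors_large : (num_attractors R d)%:R <= 2 ^+ d * (3 / 2) ^+ 48 :> R.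
Proof.
have [_ H] := attractor_classes_finite_card.
by apply: le_trans (card_signatures_exp n R); rewrite ler_nat.
Qed.

(** * Realising the family and counting exponent pairs *)

Lemma matrix_of_poly (p : {poly int}) : p \is monic -> size p = n.+2 ->
  exists M : 'M[int]_d, char_poly M = p.
Proof.
move=> pm sp; have : exists M : 'M[int]_((size p).-1), char_poly M = p.
  by exists (companionmx p); exact: companionmxK.
by rewrite sp.
Qed.

(** The digits are 0 and some e outside M Z^d, which exists since otherwise M would be invertible
    over Z, against |det M| = 2. *)
Lemma admissible_of_poly (p : {poly int}) : expanding_poly R p -> size p = n.+2 ->
  exists M d0 d1, admissible R (M : 'M[int]_d) d0 d1 /\ char_poly M = p.
Proof.
move=> ep sp; have [pm p0 pr] := ep.
have [M ME] := matrix_of_poly pm sp.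
have detM : `|\det M| = 2.
  by move: p0; rewrite -ME char_poly_det normrM normr_sign mul1r.
have [e He] : exists e : 'cV[int]_d, ~ exists v, e = M *m v.
  apply/not_existsP => H.
  have /choice [V HV] : forall j : 'I_d, exists v : 'cV[int]_d, delta_mx j 0 = M *m v.
    by move=> j; have := H (delta_mx j 0); apply: contrapT.
  have : M *m (\matrix_(i, j) V j i 0) = 1%:M.
    apply/matrixP => i j; have /matrixP/(_ i 0) := HV j; rewrite !mxE eqxx andbT => ->.
    by apply: eq_bigr => k _; rewrite mxE.
  move=> /(congr1 determinant) /(congr1 Num.norm); rewrite det_mulmx det1 normrM detM normr1.
  by move: (\det _) => x; lia.
exists M, 0, e; split=> //; split=> //; last by rewrite subr0.
by move=> z; rewrite eigenvalue_root_char -map_char_poly ME => /pr.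
Qed.

(** Take c = d - a - b. The condition a + 2 b < d says b < c and implies 2 a < d, as
    [nonparallel_of_coef] asks; the support then recovers (a, b). *)
Lemma num_attractors_lower (s : seq (nat * nat)) : uniq s ->
  (forall ab, ab \in s -> [/\ 0 < ab.1, ab.1 < ab.2 & ab.1 + ab.2.*2 < d]%N) ->
  (size s <= num_attractors R d)%N.
Proof.
move=> us Hs.
have [fin _] := attractor_classes_finite_card.
have /choice [G HG] : forall ab, exists G : set 'cV[R]_d, ab \in s ->
    exists M d0 d1, [/\ admissible R M d0 d1, G = attractor R M d0 d1,
      near_binary d (char_poly M) & forall j : 'I_d.+1,
      (j \in support d (char_poly M)) = (val j \in family_exponents ab.1 ab.2 (d - ab.1 - ab.2)%N)].
  move=> [a b]; case: (boolP ((a, b) \in s)) => [abs|]; last by exists set0.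
  have /= [a0 ab dab] := Hs _ abs.
  set c := (d - a - b)%N; have bc : (b < c)%N by rewrite /c; lia.
  have dE : d = (a + b + c)%N by rewrite /c; lia.
  have [s1 [s2 [s3 ep]]] := family_expanding a0 ab bc R.
  have nb := family_near_binary a0 ab bc s1 s2 s3.
  have sup := family_support a0 ab bc s1 s2 s3.
  rewrite -dE in nb sup.
  have [M [d0 [d1 [adm ME]]]] : exists M d0 d1,
      admissible R (M : 'M[int]_d) d0 d1 /\ char_poly M = family_poly a b c s1 s2 s3.
    by apply: admissible_of_poly => //; have [_ -> _ _] := nb.
  by exists (attractor R M d0 d1) => _; exists M, d0, d1; split; rewrite ?ME.
pose cls ab := similarity_class (G ab).
have clsP ab : ab \in s -> attractor_classes R d (cls ab).
  by move=> /HG [M [d0 [d1 [adm GE _ _]]]]; exists (G ab) => //; exists M, d0, d1.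
have inj : {in s &, injective cls}.
  move=> [a b] [a' b'] abs abs'.
  have [M [d0 [d1 [adm GE nb sup]]]] := HG _ abs.
  have [M' [d0' [d1' [adm' GE' nb' sup']]]] := HG _ abs'.
  have /= [a0 ab dab] := Hs _ abs; have /= [a0' ab' dab'] := Hs _ abs'.
  rewrite /cls GE GE' => E.
  have {E} sim : affinely_similar (attractor R M d0 d1) (attractor R M' d0' d1').
    by apply/similarity_class_eq => //; exists M', d0', d1'.
  have coefP (N : 'M[int]_d) x y : (forall j : 'I_d.+1, (j \in support d (char_poly N))
      = (val j \in family_exponents x y (d - x - y)%N)) -> (x < d.+1)%N -> (char_poly N)`_x != 0.
    move=> H xd; have := H (Ordinal xd); rewrite inE /= => ->.
    by rewrite /family_exponents !inE eqxx orbT.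
  have small x y : (x < y)%N -> (x + y.*2 < d)%N -> (x.*2 < d)%N /\ (x < d.+1)%N.
    by clear; lia.
  have [da a_d] := small _ _ ab dab; have [da' a_d'] := small _ _ ab' dab'.
  have np : pairwise_nonparallel (digit_vector R M (d1 - d0)).
    by apply: (nonparallel_of_coef adm nb da) => //; exact: coefP sup a_d.
  have np' : pairwise_nonparallel (digit_vector R M' (d1' - d0')).
    by apply: (nonparallel_of_coef adm' nb' da') => //; exact: coefP sup' a_d'.
  have := support_eq_of_similar adm adm' nb nb' np np' sim => E.
  have mem x : (x < d.+1)%N -> (x \in family_exponents a b (d - a - b)%N)
      = (x \in family_exponents a' b' (d - a' - b')%N).
    by move=> xd; rewrite -(sup (Ordinal xd)) -(sup' (Ordinal xd)) E.
  have third x y : (x < y)%N -> (x + y.*2 < d)%N -> (y < d - x - y)%N /\ (y < d.+1)%N.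
    by clear; lia.
  have [bc b_d] := third _ _ ab dab; have [bc' b_d'] := third _ _ ab' dab'.
  have lt_d x : (x <= maxn b b')%N -> (x < d.+1)%N.
    by move=> xb; rewrite (leq_ltn_trans xb) // gtn_max b_d.
  by have [-> ->] := family_exponents_inj a0 ab bc a0' ab' bc' (fun x xb => mem x (lt_d x xb)).
rewrite -(size_map cls) /num_attractors; apply: uniq_leq_size.
  by rewrite map_inj_in_uniq.
by move=> _ /mapP [ab abs ->]; rewrite in_fset_set //; apply/mem_set/clsP.
Qed.

(** For each [a] all [b] with a < b and a + 2 b < d are listed. Stopping [a] at d/4 leaves a count
    with leading term 5 d^2 / 64, above d^2 / 16. *)
Definition exponent_pairs : seq (nat * nat) :=
  [seq (a, b) | a <- iota 1 (d %/ 4), b <- iota a.+1 ((d - a - 1)./2 - a)].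

Lemma exponent_pairs_uniq : uniq exponent_pairs.
Proof.
apply: allpairs_uniq_dep; first exact: iota_uniq.
  by move=> a _; exact: iota_uniq.
by move=> [a b] [a' b'] _ _ /= [-> ->].
Qed.

Lemma exponent_pairsP ab : ab \in exponent_pairs ->
  [/\ 0 < ab.1, ab.1 < ab.2 & ab.1 + ab.2.*2 < d]%N.
Proof.
move=> /allpairsPdep [a [b [ai bi ->]]] /=; move: ai bi; rewrite !mem_iota.
by move=> h1 h2; split; lia.
Qed.

(** The lower bound of the theorem multiplied by 144. *)
Lemma size_exponent_pairs : (9 * d ^ 2 <= 144 * size exponent_pairs + 172 * d + 120)%N.
Proof.
(* Each summand is at least (d - 3 a - 2) / 2; truncated subtraction can only increase it. *)
have main m : (2 * d * m <=
    4 * sumn [seq ((d - a - 1)./2 - a)%N | a <- iota 1 m] + 3 * (m * m.+1) + 4 * m)%N.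
  elim: m => [|m IH]; first by rewrite muln0.
  rewrite (_ : iota 1 m.+1 = iota 1 m ++ [:: m.+1]); last by rewrite -{1}[m.+1]addn1 iotaD.
  rewrite map_cat sumn_cat /=.
  by move: IH; move: (sumn _) => S IH; lia.
rewrite /exponent_pairs size_allpairs_dep.
have -> : [seq size (iota a.+1 ((d - a - 1)./2 - a)) | a <- iota 1 (d %/ 4)]
  = [seq ((d - a - 1)./2 - a)%N | a <- iota 1 (d %/ 4)].
  by apply: eq_map => a; rewrite size_iota.
have := main (d %/ 4)%N; move: (sumn _) => S.
have := divn_eq d 4; have := ltn_pmod d (isT : 0 < 4)%N.
move: (d %/ 4)%N (d %% 4)%N => Q r r4 ->; nia.
Qed.
End Classes.

Theorem theorem10 (R : realType) (d : nat) (hd : (0 < d)%N) :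
  [/\ finite_set (attractor_classes R d),
      d%:R ^+ 2 / 16 - 43 * d%:R / 36 - 5 / 6 <= (num_attractors R d)%:R :> R
    & ((3 <= d)%N ->
       (num_attractors R d)%:R
         <= 2 `^ (d%:R * (1 + 16 * ln (ln d%:R) / ln d%:R)) :> R)].
Proof.
case: d hd => // n _; split.
- by have [fin _] := attractor_classes_finite_card R n.
- have h1 : (size (exponent_pairs n) <= num_attractors R n.+1)%N.
    exact: num_attractors_lower (exponent_pairs_uniq n) (@exponent_pairsP n).
  have h2 := size_exponent_pairs n.
  have : (9 * n.+1 ^ 2 <= 144 * num_attractors R n.+1 + 172 * n.+1 + 120)%N.
    by apply: leq_trans h2 _; rewrite !leq_add2r leq_mul2l.
  by rewrite -(ler_nat R) !natrD !natrM; lra.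
(* From d = 16 on the weighted count of signatures is strong enough; below, the count of all tuples
   is used. *)
- move=> d3; have [d16|d15] := leqP 16 n.+1.
    exact: le_trans (num_attractors_large R n) (upper_bound_large R d16).
  apply: le_trans (@upper_bound_small R n.+1 _); last by rewrite d3.
  by rewrite ler_nat; exact: num_attractors_small.
Qed.
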